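(* Let $\phi$ be a conjugate linear involution of a conformal vertex algebra $V$, and let $g(a)=e^{-\pi\sqrt{-1}(\Delta_a+\frac12 p(a))}\phi(a)$. The space of $\phi$-invariant Hermitian forms on $V$ is linearly isomorphic to the set of conjugate linear functionals $F\in V_0^\dagger$ such that $\langle F,L_1V_1\rangle=0$ and $\langle F,g(v)\rangle=\overline{\langle F,v\rangle}$ for all $v\in V_0$.
   Context: Base field $\mathbb C$. A vertex algebra is a vector superspace $V$ with state-field correspondence $Y(a,z)=\sum_{n\in\mathbb Z}a_{(n)}z^{-n-1}$, vacuum $\mathbf 1$ and translation operator $T$ (i.e. a vertex superalgebra). $p(a)\in\{0,1\}\subset\mathbb Z$ is the parity. Conformal vertex algebra: there is a distinguished vector $L\in V_2$ with $Y(L,z)=\sum_n L_nz^{-n-2}$, $[L_m,L_n]=(m-n)L_{m+n}+\frac1{12}(m^3-m)\delta_{m+n,0}\,c\,I$, $L_{-1}=T$, $L_0$ diagonalizable with eigenspace decomposition $V=\bigoplus_{n\in\frac12\mathbb Z_{\ge0}}V_n$, $\dim V_n<\infty$, $V_0=\mathbb C\mathbf 1$. $\Delta_a$ is the $L_0$-eigenvalue of $a\in V_{\Delta_a}$. A conjugate linear involution of $V$ is a parity preserving conjugate linear map $\phi:V\to V$ with $\phi^2=I$, $\phi(u_{(n)}v)=\phi(u)_{(n)}\phi(v)$ for all $n\in\mathbb Z$, and $\phi(L)=L$. Put $A(z)v=e^{zL_1}z^{-2L_0}g(v)$, so $A(z):V\to V((z))$. A Hermitian form on $V$ is a map $(\cdot,\cdot):V\times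 V\to\mathbb C$, conjugate linear in the first and linear in the second argument, with $(v_1,v_2)=\overline{(v_2,v_1)}$. It is $\phi$-invariant if $(v,Y(a,z)u)=(Y(A(z)a,z^{-1})v,u)$ for all $a,u,v\in V$. $V_0^\dagger$ is the space of conjugate linear maps $V_0\to\mathbb C$, and $\langle F,v\rangle=F(v)$. Both sets in the claim are real vector spaces, and ''linearly isomorphic'' is meant as real vector spaces. *)

(* Defs.v *)
From HB Require Import structures.
From mathcomp Require Import all_boot all_order all_algebra.
From mathcomp Require Import all_classical all_reals all_analysis.
From mathcomp Require Export complex.

Set Implicit Arguments.
Unset Strict Implicit.
Unset Printing Implicit Defensive.

Import Order.TTheory GRing.Theory Num.Theory.
Local Open Scope classical_set_scope.
Local Open Scope ring_scope.

(* All sums [\sum_(i \in A) F i] over infinite index sets are sums of finitely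
   supported families. *)

(* The binomial coefficient m (m - 1) ... (m - j + 1) / j! for m in Z. *)
Definition binomz (K : fieldType) (m : int) (j : nat) : K :=
  (\prod_(i < j) (m%:~R - i%:R)) / j`!%:R.

Definition cexp (R : realType) (z : R[i]) : R[i] :=
  Complex (expR (complex.Re z) * cos (complex.Im z))
          (expR (complex.Re z) * sin (complex.Im z)).

(* Vertex algebras over C = R[i], in the super sense.
   - [nprod a n b] is a_(n) b, so that Y(a,z) b = sum_n (a_(n) b) z^(-n-1).
   - The superspace decomposition is given by its two projections: [par p]
     projects onto the subspace of parity p (true is odd).
   - [va_borcherds] is the Borcherds identity, i.e. the Jacobi identity written
     in modes. *)
Record vertexAlgebra (R : realType) := VertexAlgebra {
  va_space :> lmodType R[i];
  par : bool -> va_space -> va_space;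
  vacuum : va_space;
  nprod : va_space -> int -> va_space -> va_space;
  par_linear : forall p, linear (par p);
  par_sum : forall v, par false v + par true v = v;
  par_par : forall p q v, par p (par q v) = if p == q then par q v else 0;
  nprod_linearl : forall n b, linear (fun a => nprod a n b);
  nprod_linearr : forall a n, linear (nprod a n);
  nprod_trunc : forall a b, exists N : int, forall n, N <= n -> nprod a n b = 0;
  nprod_par : forall p q a n b, par p a = a -> par q b = b ->
    par (p (+) q) (nprod a n b) = nprod a n b;
  vacuum_even : par false vacuum = vacuum;
  vacuum_l : forall n a, nprod vacuum n a = if n == -1 then a else 0;
  vacuum_r : forall a n, -1 <= n -> nprod a n vacuum = if n == -1 then a else 0;
  va_borcherds : forall p q a b c (l m n : int), par p a = a -> par q b = b ->
    \sum_(j \in [set: nat])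
       binomz R[i] m j *: nprod (nprod a (l + j%:Z) b) (m + n - j%:Z) c =
    \sum_(j \in [set: nat])
       ((-1) ^+ j * binomz R[i] l j) *:
         (nprod a (m + l - j%:Z) (nprod b (n + j%:Z) c)
          - ((-1) ^ l * (-1) ^+ (p && q)) *:
              nprod b (l + n - j%:Z) (nprod a (m + j%:Z) c))
}.

(* T a = a_(-2) 1 *)
Definition translation (R : realType) (V : vertexAlgebra R) (a : V) : V :=
  nprod a (- 2) (vacuum V).

(* L_n, where Y(L,z) = sum_n L_n z^(-n-2): L_n = L_(n+1) *)
Definition modeL (R : realType) (V : vertexAlgebra R) (L : V) (n : int) :
  V -> V := nprod L (n + 1).

(* [wcomp k v] is the component of v in V_(k/2), k in N; weights are indexed by
   their doubles. *)
Record conformalVertexAlgebra (R : realType) := ConformalVertexAlgebra {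
  cva_va :> vertexAlgebra R;
  conformal_vector : cva_va;
  central_charge : R[i];
  wcomp : nat -> cva_va -> cva_va;
  conformal_even : par false conformal_vector = conformal_vector;
  conformal_weight :
    modeL conformal_vector 0 conformal_vector = 2%:R *: conformal_vector;
  virasoro : forall (m n : int) v,
    modeL conformal_vector m (modeL conformal_vector n v)
    - modeL conformal_vector n (modeL conformal_vector m v) =
    (m - n)%:~R *: modeL conformal_vector (m + n) v
    + (12%:R^-1 * (m ^+ 3 - m)%:~R * (m + n == 0)%:R * central_charge) *: v;
  conformal_translation : forall v,
    modeL conformal_vector (- 1) v = translation v;
  wcomp_weight : forall k v,
    modeL conformal_vector 0 (wcomp k v) = (k%:R / 2%:R) *: wcomp k v;
  wcomp_sum : forall v, exists N, forall M, (N <= M)%N ->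
    v = \sum_(k < M) wcomp k v;
  weight_findim : forall k, exists s : seq cva_va, forall v,
    modeL conformal_vector 0 v = (k%:R / 2%:R) *: v ->
    exists x : 'I_(size s) -> R[i], v = \sum_(i < size s) x i *: s`_i;
  weight0 : forall v,
    modeL conformal_vector 0 v = 0 <-> exists x : R[i], v = x *: vacuum cva_va
}.

Section Weights.
Context (R : realType) (V : conformalVertexAlgebra R).
Implicit Types (D : R[i]) (n : int) (u v : V).

Definition L_ n : V -> V := modeL (conformal_vector V) n.

Lemma L_linear n : linear (L_ n).
Proof. exact: nprod_linearr. Qed.

HB.instance Definition _ n := GRing.isLinear.Build R[i] V V *:%R (L_ n)
  (L_linear n).

Definition weight_pred D : {pred V} := [pred v | L_ 0 v == D *: v].

Lemma weight_predP D v : reflect (L_ 0 v = D *: v) (v \in weight_pred D).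
Proof. by rewrite inE; exact: eqP. Qed.

Lemma weight_submod_closed D : submod_closed (weight_pred D).
Proof.
split=> [|a u v /weight_predP hu /weight_predP hv]; apply/weight_predP.
  by rewrite linear0 scaler0.
by rewrite linearP /= hu hv scalerDr !scalerA mulrC.
Qed.

HB.instance Definition _ D := GRing.isSubmodClosed.Build R[i] V (weight_pred D)
  (weight_submod_closed D).

Record wspace D := Wspace { wspace_val :> V; _ : wspace_val \in weight_pred D }.

HB.instance Definition _ D := [isSub for @wspace_val D].
HB.instance Definition _ D := [Choice of wspace D by <:].
HB.instance Definition _ D := [SubChoice_isSubLmodule of wspace D by <:].

Lemma weight_sum_eq0 N (f : nat -> V) :
  (forall k, f k \in weight_pred (k%:R / 2%:R)) ->
  \sum_(k < N) f k = 0 -> forall k, (k < N)%N -> f k = 0.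
Proof.
elim: N f => [//|N IH] f hf sf0.
have shift k : L_ 0 (f k) - (N%:R / 2%:R) *: f k =
    ((k%:R - N%:R) / 2%:R) *: f k.
  by rewrite (weight_predP _ _ (hf k)) -scalerBl -mulrBl.
have lt0 k : (k < N)%N -> f k = 0.
  move=> kN; have /eqP : ((k%:R - N%:R) / 2%:R) *: f k = 0.
    apply: (IH (fun k => ((k%:R - N%:R) / 2%:R) *: f k)) => // [i|].
      exact: rpredZ.
    have := congr1 (fun w => L_ 0 w - (N%:R / 2%:R) *: w) sf0.
    rewrite linear0 scaler0 subrr linear_sum scaler_sumr -sumrB.
    rewrite big_ord_recr /= shift subrr mul0r scale0r addr0.
    by move=> sN; rewrite -[RHS]sN; apply: eq_bigr => i _; rewrite shift.
  rewrite scaler_eq0 mulf_eq0 subr_eq0 eqr_nat ltn_eqF // invr_eq0 pnatr_eq0.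
  by move=> /eqP.
move=> k; rewrite ltnS leq_eqVlt => /orP[/eqP->|/lt0 //].
by move: sf0; rewrite big_ord_recr /= big1 ?add0r // => i _; apply: lt0.
Qed.

Lemma wcomp_id (n : nat) v : v \in weight_pred (n%:R / 2%:R) ->
  forall k, wcomp k v = if k == n then v else 0.
Proof.
move=> hv k; have [N hN] := wcomp_sum v.
pose f i := wcomp i v - (if i == n then v else 0).
have fW i : f i \in weight_pred (i%:R / 2%:R).
  apply: rpredB; first by apply/weight_predP; exact: wcomp_weight.
  by case: eqP => [->//|_]; apply: rpred0.
pose M := (maxn N (maxn n k)).+1.
have nM : (n < M)%N by rewrite ltnS !leq_max leqnn orbT.
have kM : (k < M)%N by rewrite ltnS !leq_max leqnn !orbT.
apply/eqP; rewrite -subr_eq0; apply/eqP; apply: (weight_sum_eq0 fW _ kM).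
rewrite sumrB -(hN M) ?(leq_trans (leq_maxl _ _) (leqnSn _)) //.
rewrite (bigD1 (Ordinal nM)) //= eqxx big1 ?addr0 ?subrr // => i.
by rewrite -val_eqE /= => /negbTE ->.
Qed.

Lemma L1_weight0 (v : wspace 1) : L_ 1 v \in weight_pred 0.
Proof.
have /weight_predP hv := valP v; apply/weight_predP; rewrite scale0r.
have := @virasoro R V 0 1 v; rewrite -!/(L_ _) hv scale1r !add0r.
rewrite oner_eq0 mulr0 mul0r scale0r addr0 rmorphN1 scaleN1r => /eqP.
by rewrite subr_eq addNr => /eqP.
Qed.

Definition L1 (v : wspace 1) : wspace 0 := Wspace (L1_weight0 v).

End Weights.

Arguments weight_pred {R} V D.

Record conjInvolution (R : realType) (V : conformalVertexAlgebra R) :=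
  ConjInvolution {
  ci_fun :> V -> V;
  ci_par : forall p v, par p v = v -> par p (ci_fun v) = ci_fun v;
  ci_conj_linear : linear_for (Num.conj \; *:%R) ci_fun;
  ci_involutive : involutive ci_fun;
  ci_nprod : forall u n v, ci_fun (nprod u n v) = nprod (ci_fun u) n (ci_fun v);
  ci_conformal : ci_fun (conformal_vector V) = conformal_vector V
}.

Section HermitianForms.
Context (R : realType) (V : conformalVertexAlgebra R) (phi : conjInvolution V).
Implicit Types (a u v w : V).

(* g(a) = e^(-pi i (Delta_a + p(a)/2)) phi(a) for homogeneous a, extended
   additively. *)
Definition g a : V :=
  \sum_(k \in [set: nat]) \sum_(p : bool)
    cexp (- (real_complex R pi * 'i * (k%:R / 2%:R + p%:R / 2%:R)))
      *: phi (par p (wcomp k a)).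

(* The coefficient of z^i in A(z) v = e^(z L_1) z^(-2 L_0) g(v): the sum over
   j - k = i of L_1^j / j! applied to the component of g(v) of weight k/2. *)
Definition A_coef v (i : int) : V :=
  \sum_(jk \in [set jk : nat * nat | jk.1%:Z - jk.2%:Z = i])
    (jk.1`!%:R^-1 : R[i]) *: iter jk.1 (L_ 1) (wcomp jk.2 (g v)).

(* The coefficient of z^m in Y(a,z) v. *)
Definition Y_coef a v (m : int) : V := nprod a (- m - 1) v.

(* The coefficient of z^m in Y(A(z) a, z^-1) v. *)
Definition YA_coef a v (m : int) : V :=
  \sum_(i \in [set: int]) Y_coef (A_coef a i) v (i - m).

Definition hermitian (B : V -> V -> R[i]) : Prop :=
  [/\ forall w, linear_for (Num.conj \; *%R) (B^~ w),
      forall v, linear_for *%R (B v) &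
      forall v w, B v w = (B w v)^*].

(* (v, Y(a,z) u) = (Y(A(z) a, z^-1) v, u), coefficientwise; the formal variable
   z is fixed by complex conjugation. *)
Definition invariant (B : V -> V -> R[i]) : Prop :=
  forall a u v (m : int), B v (Y_coef a u m) = B (YA_coef a v m) u.

(* [Rcomplex R] is C as a real vector space. *)
Definition invform_pred : {pred V -> V -> Rcomplex R} :=
  [pred B | `[< hermitian B /\ invariant B >]].

Lemma invform_submod_closed : submod_closed invform_pred.
Proof.
have scE (r : R) (z : Rcomplex R) : r *: z = real_complex R r * z :> R[i].
  by case: z => x y; apply/eqP; rewrite eq_complex /= !mul0r subr0 addr0 !eqxx.
have conj_rc (r : R) : (real_complex R r)^* = real_complex R r.
  by apply/eqP; rewrite eq_complex /= oppr0 !eqxx.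
split=> [|r B1 B2 /asboolP[[l1 r1 h1] i1] /asboolP[[l2 r2 h2] i2]];
  apply/asboolP.
  split; last by [].
  split=> [w a u v|w a u v|v w] /=; try exact/esym/conjC0.
    by rewrite -[RHS]/(a^* * (0 : R[i]) + 0) mulr0 addr0.
  by rewrite -[RHS]/(a * (0 : R[i]) + 0) mulr0 addr0.
have BE v w : (r *: B1 + B2) v w = real_complex R r * B1 v w + B2 v w :> R[i].
  by rewrite -scE.
split; first split.
- move=> w a u v; rewrite /= !BE; have /= -> := l1 w a u v.
  by have /= -> := l2 w a u v; rewrite !mulrDr addrACA mulrCA.
- move=> w a u v; rewrite /= !BE r1 r2 /=.
  by rewrite !mulrDr addrACA mulrCA.
- by move=> v w; rewrite !BE h1 h2 rmorphD rmorphM /= conj_rc.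
by move=> a u v m; rewrite !BE i1 i2.
Qed.

HB.instance Definition _ := GRing.isSubmodClosed.Build R (V -> V -> Rcomplex R)
  invform_pred invform_submod_closed.

(* The real vector space of phi-invariant Hermitian forms on V *)
Record invariantForm := InvariantForm {
  invform_val :> V -> V -> Rcomplex R;
  _ : invform_val \in invform_pred
}.

HB.instance Definition _ := [isSub for invform_val].
HB.instance Definition _ := [Choice of invariantForm by <:].
HB.instance Definition _ := [SubChoice_isSubLmodule of invariantForm by <:].

Lemma g_weight0 (v : wspace V 0) : g v \in weight_pred V 0.
Proof.
have h0 : (v : V) \in weight_pred V (0%:R / 2%:R) by rewrite mul0r; exact: valP.
have phi0 : phi 0 = 0.
  have := ci_conj_linear phi (- 1) 0 0.
  by rewrite scaler0 addr0 /= rmorphN1 scaleN1r addNr.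
have par0 p : par p (0 : V) = 0.
  by have := @par_linear R V p (- 1) 0 0; rewrite scaler0 addr0 scaleN1r addNr.
have L0par p : L_ 0 (par p v) = 0.
  have parL q w : par q w = w -> par q (L_ 0 w) = L_ 0 w.
    by have := @nprod_par R V false q _ 1 w (conformal_even V).
  have pp q : par q (par q (v : V)) = par q v by rewrite par_par eqxx.
  have sumE : L_ 0 (par false v) + L_ 0 (par true v) = 0.
    rewrite -linearD par_sum /=.
    by have /weight_predP := valP v; rewrite scale0r.
  have parD q : {morph par q : x y / x + y : V}.
    by move=> x y; have := @par_linear R V q 1 x y; rewrite !scale1r.
  have := congr1 (par p) sumE; rewrite par0 parD.
  rewrite -(parL _ _ (pp false)) -(parL _ _ (pp true)) !par_par.
  by case: p => /=; rewrite ?add0r ?addr0 parL.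
apply: rpred_sum => k _; apply: rpred_sum => p _; apply: rpredZ.
rewrite (wcomp_id h0); case: eqP => _; last by rewrite par0 phi0 rpred0.
apply/weight_predP; rewrite scale0r /L_ /modeL -(ci_conformal phi) -ci_nprod.
by have := L0par p; rewrite /L_ /modeL => ->; rewrite phi0.
Qed.

Definition g0 (v : wspace V 0) : wspace V 0 := Wspace (g_weight0 v).

Definition functional_pred : {pred wspace V 0 -> Rcomplex R} :=
  [pred F : wspace V 0 -> R[i] |
    `[< [/\ linear_for (Num.conj \; *%R) F,
            forall v : wspace V 1, F (L1 v) = 0 &
            forall v : wspace V 0, F (g0 v) = (F v)^*] >]].

Lemma functional_submod_closed : submod_closed functional_pred.
Proof.
have scE (r : R) (z : Rcomplex R) : r *: z = real_complex R r * z :> R[i].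
  by case: z => x y; apply/eqP; rewrite eq_complex /= !mul0r subr0 addr0 !eqxx.
have conj_rc (r : R) : (real_complex R r)^* = real_complex R r.
  by apply/eqP; rewrite eq_complex /= oppr0 !eqxx.
split=> [|r F1 F2 /asboolP[l1 z1 h1] /asboolP[l2 z2 h2]]; apply/asboolP.
  split=> [a u v|v|v] //=; last exact/esym/conjC0.
  by rewrite -[RHS]/(a^* * (0 : R[i]) + 0) mulr0 addr0.
have FE (v : wspace V 0) : (r *: F1 + F2) v = real_complex R r * F1 v + F2 v :> R[i].
  by rewrite -scE.
split=> [a u v|v|v]; rewrite !FE.
- have /= -> := l1 a u v; have /= -> := l2 a u v.
  by rewrite /= !mulrDr addrACA mulrCA.
- by rewrite z1 z2 mulr0 addr0.
by rewrite h1 h2 rmorphD rmorphM /= conj_rc.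
Qed.

HB.instance Definition _ := GRing.isSubmodClosed.Build R
  (wspace V 0 -> Rcomplex R) functional_pred functional_submod_closed.

(* The real vector space of conjugate linear functionals F on V_0 such that
   F(L_1 V_1) = 0 and F(g(v)) is the conjugate of F(v) *)
Record realFunctional := RealFunctional {
  functional_val :> wspace V 0 -> Rcomplex R;
  _ : functional_val \in functional_pred
}.

HB.instance Definition _ := [isSub for functional_val].
HB.instance Definition _ := [Choice of realFunctional by <:].
HB.instance Definition _ := [SubChoice_isSubLmodule of realFunctional by <:].

End HermitianForms.

(* Main.v *)
From HB Require Import structures.
Require Import Defs.
From mathcomp Require Import all_boot all_order all_algebra.
From mathcomp Require Import all_classical all_reals all_analysis.
From mathcomp Require Import ring lra zify.

(* A form B is determined by F(v) = B(v, 1), since u = u_(-1) 1 gives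
   B(v, u) = F(u_(-1)^dagger v), where a_(n)^dagger is the mode adjoint to a_(n)
   prescribed by invariance; moreover F vanishes in positive weight because L_0
   is self-adjoint, and F(L_1 v) = B(v, L_(-1) 1) = 0.

   Conversely, given F, define B by this formula.  If F = 0, nothing is to be
   proved; otherwise V_0 = C 1 forces L_1 V_1 = 0, and then L_1 L_(-1) is
   invertible in positive weights, so that V is spanned by the L_(-1)^r q with q
   quasi-primary (L_1 q = 0).  For quasi-primary a the adjoint mode has a single
   term, and B is compatible with L_1 and L_(-1), so symmetry and invariance
   reduce to quasi-primary vectors.  There they say how the three-point function
   F(c_(2h_c-1) a_(n) b) behaves under permutations of a, b, c: exchanging a and
   b is skew-symmetry, exchanging c and a is a degenerate Borcherds identity,
   and the signs match the phases of g. *)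

Set Implicit Arguments.
Unset Strict Implicit.
Unset Printing Implicit Defensive.

Import Order.TTheory GRing.Theory Num.Theory.
Local Open Scope classical_set_scope.
Local Open Scope ring_scope.

(** * Finitely supported sums and generalized binomial coefficients *)

Lemma fsum_ord (U : nmodType) (f : nat -> U) N :
  (forall j, (N <= j)%N -> f j = 0) ->
  \sum_(j \in [set: nat]) f j = \sum_(j < N) f j.
Proof.
move=> f0; rewrite -(big_mkord xpredT) (fsbigE (index_iota 0 N)) //.
- by apply: eq_bigl => i; rewrite in_setT.
- exact: iota_uniq.
- by move=> i _; rewrite mem_index_iota -leqNgt => /f0.
Qed.

Section Binomials.
Context (K : numFieldType).

Lemma binomz_nat n j : binomz K n%:Z j = 'C(n, j)%:R.
Proof.
rewrite /binomz.
have -> : \prod_(i < j) ((n%:Z)%:~R - i%:R) = (n ^_ j)%:R :> K.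
  elim: j => [|j IH]; first by rewrite big_ord0.
  rewrite big_ord_recr /= IH ffactnSr natrM.
  (* For n < j the truncated n - j is not the integer difference, but the falling factorial is
     already 0. *)
  have [jn|nj] := leqP j n; first by rewrite natrB.
  by rewrite ffact_small // !mul0r.
by rewrite -bin_ffact natrM mulfK // pnatr_eq0 -lt0n fact_gt0.
Qed.

Lemma binomzN1 j : binomz K (- 1) j = (-1) ^+ j.
Proof.
rewrite /binomz.
have -> : \prod_(i < j) ((- 1)%:~R - i%:R) = (-1) ^+ j * j`!%:R :> K.
  elim: j => [|j IH]; first by rewrite big_ord0 mulr1.
  by rewrite big_ord_recr /= IH factS natrM exprS -natr1 rmorphN1; ring.
by rewrite mulfK // pnatr_eq0 -lt0n fact_gt0.
Qed.

Lemma binomzN2 j : binomz K (- 2) j = (-1) ^+ j * j.+1%:R.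
Proof.
rewrite /binomz.
have -> : \prod_(i < j) ((- 2)%:~R - i%:R) = (-1) ^+ j * j.+1`!%:R :> K.
  elim: j => [|j IH]; first by rewrite big_ord0 mulr1.
  rewrite big_ord_recr /= IH (factS j.+1) natrM exprS -[j.+2]addn2 natrD.
  by rewrite rmorphN /=; ring.
by rewrite factS natrM mulrA mulfK // pnatr_eq0 -lt0n fact_gt0.
Qed.

End Binomials.

(** * Consequences of the Borcherds identity: commutators, translation, skew-symmetry *)

Section VertexAlgebra.
Context (R : realType) (V : vertexAlgebra R).
Implicit Types (a b c u v w : V) (p q : bool) (l m n : int).

HB.instance Definition _ a n := GRing.isLinear.Build R[i] V V *:%R (nprod a n)
  (nprod_linearr a n).

HB.instance Definition _ p := GRing.isLinear.Build R[i] V V *:%R (@par R V p)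
  (par_linear p).

Definition nprodl n b : V -> V := fun a => nprod a n b.

HB.instance Definition _ n b := GRing.isLinear.Build R[i] V V *:%R (nprodl n b)
  (nprod_linearl n b).

Lemma nprod0l n b : nprod 0 n b = 0.
Proof. exact: (linear0 (nprodl n b)). Qed.

Lemma nprodDl n b : {morph (fun a => nprod a n b) : a c / a + c}.
Proof. exact: (linearD (nprodl n b)). Qed.

Lemma nprodZl n b x a : nprod (x *: a) n b = x *: nprod a n b.
Proof. exact: (linearZ_LR (nprodl n b)). Qed.

Lemma nprod_suml n b I (r : seq I) P (F : I -> V) :
  nprod (\sum_(i <- r | P i) F i) n b = \sum_(i <- r | P i) nprod (F i) n b.
Proof. exact: (linear_sum (nprodl n b)). Qed.

Lemma nprod_eventually0 a b n :
  exists N : nat, forall j, (N <= j)%N -> nprod a (n + j%:Z) b = 0.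
Proof.
have [N hN] := nprod_trunc a b; exists `|N - n|%N => j Nj.
by apply: hN; lia.
Qed.

(** Truncation bounds all three families of modes, so both sums may be cut at a common length. Any
    larger length also works, which allows several instances to be combined. *)
Lemma borcherds_ord p q a b c l m n : par p a = a -> par q b = b ->
  exists N, forall M, (N <= M)%N ->
  \sum_(j < M) binomz R[i] m j *:
      nprod (nprod a (l + j%:Z) b) (m + n - j%:Z) c =
  \sum_(j < M) ((-1) ^+ j * binomz R[i] l j) *:
      (nprod a (m + l - j%:Z) (nprod b (n + j%:Z) c)
       - ((-1) ^ l * (-1) ^+ (p && q)) *:
           nprod b (l + n - j%:Z) (nprod a (m + j%:Z) c)).
Proof.
move=> pa qb.
have [N1 h1] := nprod_eventually0 a b l.
have [N2 h2] := nprod_eventually0 b c n.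
have [N3 h3] := nprod_eventually0 a c m.
exists (N1 + N2 + N3)%N => M NM.
have := va_borcherds c l m n pa qb.
rewrite (@fsum_ord _ _ M) => [->|j Mj]; last first.
  by rewrite h1 ?nprod0l ?scaler0 //; lia.
rewrite (@fsum_ord _ _ M) // => j Mj.
by rewrite h2 ?h3 ?linear0 ?(scaler0, oppr0, addr0) //; lia.
Qed.

Lemma par_dec (P : V -> Prop) : (forall u v, P u -> P v -> P (u + v)) ->
  (forall p v, par p v = v -> P v) -> forall v, P v.
Proof.
move=> PD Pp v; rewrite -(par_sum v).
by apply: PD; [apply: (Pp false)|apply: (Pp true)]; rewrite par_par eqxx.
Qed.

(** Borcherds at l = 0: the binomial of 0 over j leaves only j = 0 on the right, and a even [a]
    produces no sign. *)
Lemma commutator_even a b c m n : par false a = a ->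
  exists N, forall M, (N <= M)%N ->
  nprod a m (nprod b n c) - nprod b n (nprod a m c) =
  \sum_(j < M) binomz R[i] m j *: nprod (nprod a j b) (m + n - j%:Z) c.
Proof.
move=> ea; elim/par_dec: b => [u v [N1 h1] [N2 h2]|q b qb].
  exists (N1 + N2)%N => M NM.
  rewrite !nprodDl linearD /= opprD addrACA (h1 M) ?(h2 M); try lia.
  rewrite -big_split /=; apply: eq_bigr => j _.
  by rewrite linearD /= nprodDl scalerDr.
have [N h] := borcherds_ord c 0 m n ea qb.
exists N.+1 => M NM; move: (h M (ltnW NM)).
under eq_bigr do rewrite add0r.
move=> ->; case: M NM => // M NM.
rewrite big_ord_recl big1 => [|i _]; last first.
  by rewrite binomz_nat bin0n /= mulr0 scale0r.
rewrite binomz_nat bin0 /= !expr0 !mulr1 !scale1r.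
by rewrite ?(addr0, add0r, subr0).
Qed.

(** Borcherds for [b] and the vacuum at l = -2, m = 0. The left side keeps only j = 0. On the right
    the vacuum acts only through its mode -1, so what survives is j = -n - 1 if n < 0, j = n - 1 if
    n > 0, and nothing if n = 0. *)
Lemma vacuum_derivative b c n :
  nprod (translation b) n c = - n%:~R *: nprod b (n - 1) c.
Proof.
rewrite /translation; elim/par_dec: b => [u v hu hv|p b pb].
  by rewrite !nprodDl scalerDr hu hv.
have [N h] := borcherds_ord c (- 2) 0 n pb (vacuum_even V).
(* The length exceeds |n|, so that both possible surviving indices are in range. *)
have {h} := h (N + `|n| + 1)%N ltac:(lia).
rewrite addnS big_ord_recl big1 => [|i _]; last first.
  by rewrite (binomz_nat _ 0) bin0n scale0r.
rewrite (binomz_nat _ 0) bin0 scale1r ?(addr0, add0r, subr0) => ->.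
set K := (N + `|n| + 0)%N.
have -> : \sum_(j < K.+1) ((-1) ^+ j * binomz R[i] (- 2) j) *:
    (nprod b (0 - 2 - j%:Z) (nprod (vacuum V) (n + j%:Z) c) -
     ((-1) ^ (- 2) * (-1) ^+ (p && false)) *:
      nprod (vacuum V) (- 2 + n - j%:Z) (nprod b (0 + j%:Z) c)) =
  \sum_(j < K.+1) ((if j%:Z == - n - 1 then j.+1%:R *: nprod b (n - 1) c else 0)
    - (if j%:Z == n - 1 then j.+1%:R *: nprod b (n - 1) c else 0)).
  apply: eq_bigr => j _.
  rewrite binomzN2 mulrA -expr2 sqrr_sign mul1r andbF mulr1.
  have -> : (-1) ^ (- 2) = 1 :> R[i] by rewrite -exprnN sqrrN expr1n invr1.
  rewrite !vacuum_l scale1r scalerBr.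
  have -> : (n + j%:Z == -1) = (j%:Z == - n - 1) by lia.
  have -> : (- 2 + n - j%:Z == -1) = (j%:Z == n - 1) by lia.
  congr (_ - _).
    case: eqP => [jn|_]; last by rewrite linear0 scaler0.
    by congr (_ *: nprod _ _ _); lia.
  case: eqP => [jn|_]; last by rewrite scaler0.
  by congr (_ *: nprod _ _ _); lia.
rewrite sumrB.
have pick (x : int) : (x < K.+1%:Z) ->
    \sum_(j < K.+1) (if j%:Z == x then j.+1%:R *: nprod b (n - 1) c else 0) =
    if 0 <= x then (x + 1)%:~R *: nprod b (n - 1) c else 0.
  move=> xK; case: ifP => x0; last first.
    by rewrite big1 // => j _; case: eqP => // jx; lia.
  have xK' : (`|x| < K.+1)%N by lia.
  rewrite (bigD1 (Ordinal xK')) //= big1 => [|j]; last first.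
    by rewrite -val_eqE /= => /eqP jx; case: eqP => // ?; lia.
  case: eqP => [|?]; last by lia.
  move=> <-; rewrite addr0 -natr1 -[X in _ *: X]/(nprod b (n - 1) c).
  by rewrite rmorphD /=.
rewrite !pick; try by rewrite /K; lia.
have [n0|n0|->] := ltgtP n 0; last by rewrite /= subr0 oppr0 scale0r.
  rewrite ifT ?ifF; try lia.
  by rewrite subr0 subrK rmorphN.
rewrite ifF ?ifT; try lia.
by rewrite sub0r subrK scaleNr.
Qed.

(* Borcherds' identity at m = -1, n = 0, applied to the vacuum, is
   skew-symmetry: sum_j (-1)^j T^j/j! a_(l+j) b = - (-1)^(l + pq) b_(l) a. *)
Lemma skew_symmetry (G : {scalar V}) p q a b l :
  par p a = a -> par q b = b ->
  (forall (j : nat) w, G (nprod w (- 2 - j%:Z) (vacuum V)) = 0) ->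
  G (nprod b l a) = (-1) ^ (l + 1) * (-1) ^+ (p && q) * G (nprod a l b).
Proof.
move=> pa qb GT.
have [N h] := borcherds_ord (vacuum V) l (- 1) 0 pa qb.
have {h} := congr1 G (h N.+1 (leqnSn N)).
rewrite !big_ord_recl !linearD /= !linear_sum /= big1 => [|i _]; last first.
  rewrite linearZ /= [X in nprod _ X _](_ : _ = - 2 - i%:Z) ?GT ?mulr0 //=.
  by rewrite /bump /=; lia.
rewrite big1 => [|i _]; last first.
  rewrite linearZ /= !vacuum_r ?ifF ?linear0 ?(scaler0, oppr0, addr0, linear0,
    mulr0) //;
  rewrite /bump /=; lia.
have -> : binomz R[i] (-1) 0 = 1 by rewrite binomzN1.
have -> : binomz R[i] l 0 = 1 by rewrite /binomz big_ord0 divr1.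
rewrite !vacuum_r //= linear0 expr0 mulr1 !scale1r ?(addr0, add0r, subr0,
  linear0).
move=> ->; rewrite linearN linearZ /= mulrN mulrA.
rewrite (expfzDr _ _ (_ : -1 != 0)) ?oppr_eq0 ?oner_eq0 // expr1z mulrN1.
rewrite expN1r -signr_odd.
by case: (odd _) (p && q) => [] []; rewrite ?expr0 ?expr1; ring.
Qed.

End VertexAlgebra.

(** * Commutators of modes with L_(-1), L_0 and L_1 *)

Section Conformal.
Context (R : realType) (V : conformalVertexAlgebra R).
Implicit Types (a b c u v w : V) (p q : bool) (k l m n : int) (x : R[i]).

Local Notation T := (@L_ R V (- 1)).
Local Notation L0 := (@L_ R V 0).
Local Notation L1 := (@L_ R V 1).
(* Weights are doubled, as in [wcomp]. *)
Local Notation wt k := (weight_pred V (k%:~R / 2%:R)).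

(** The commutator formula for the conformal vector, with L_(m-1) its mode m. As m is a natural
    number, the binomials stop the sum at j = m; m = 0, 1, 2 give the commutators with L_(-1), L_0,
    L_1. *)
Lemma L_mode_comm b c (m : nat) n :
  L_ (m%:Z - 1) (nprod b n c) - nprod b n (L_ (m%:Z - 1) c) =
  \sum_(j < m.+1) 'C(m, j)%:R *: nprod (L_ (j%:Z - 1) b) (m%:Z + n - j%:Z) c.
Proof.
have [N h] := commutator_even b c m n (conformal_even V).
move: (h (m.+1 + N)%N (leq_addl _ _)); rewrite /L_ /modeL subrK => ->.
rewrite big_split_ord /= [X in _ + X]big1 ?addr0 => [|j _]; last first.
  by rewrite binomz_nat bin_small ?scale0r //; lia.
by apply: eq_bigr => j _; rewrite binomz_nat subrK.
Qed.

Lemma T_der b c n : nprod (T b) n c = - n%:~R *: nprod b (n - 1) c.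
Proof. by rewrite /L_ conformal_translation vacuum_derivative. Qed.

Lemma T_comm b c n :
  T (nprod b n c) = nprod b n (T c) - n%:~R *: nprod b (n - 1) c.
Proof.
apply/eqP; rewrite addrC -subr_eq -scaleNr -T_der; apply/eqP.
have := L_mode_comm b c 0 n; rewrite sub0r => ->.
by rewrite big_ord1 bin0 scale1r sub0r add0r oppr0 addr0.
Qed.

Lemma L0_comm b c n :
  L0 (nprod b n c) = nprod b n (L0 c) + nprod (L0 b) n c
    - (n + 1)%:~R *: nprod b n c.
Proof.
apply/eqP; rewrite -addrA addrC -subr_eq; apply/eqP.
have := L_mode_comm b c 1 n; rewrite subrr => ->.
rewrite !big_ord_recr big_ord0 /= bin0 bin1 !scale1r !add0r T_der.
rewrite (_ : 1%:Z + n - 0%:Z = n + 1); last by lia.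
by rewrite (_ : 1%:Z + n - 1%:Z = n) ?addrK 1?addrC ?scaleNr //; lia.
Qed.

Lemma L1_comm b c n :
  L1 (nprod b n c) = nprod b n (L1 c) + nprod (L1 b) n c
    + (2%:R *: nprod (L0 b) (n + 1) c - (n + 2)%:~R *: nprod b (n + 1) c).
Proof.
apply/eqP; rewrite -addrA addrC -subr_eq; apply/eqP.
have := L_mode_comm b c 2 n; rewrite (_ : 2%:Z - 1 = 1) // => ->.
rewrite !big_ord_recr big_ord0 /= bin0 bin1 binn !scale1r !add0r T_der.
rewrite (_ : 2%:Z + n - 0%:Z = n + 2); last by lia.
rewrite (_ : n + 2 - 1 = n + 1); last by lia.
rewrite (_ : 2%:Z + n - 1%:Z = n + 1); last by lia.
rewrite (_ : 2%:Z + n - 2%:Z = n); last by lia.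
by rewrite addrC scaleNr [- _ + _]addrC.
Qed.

Lemma L1_T v : L1 (T v) = T (L1 v) + 2%:R *: L0 v.
Proof.
apply/eqP; rewrite addrC -subr_eq. apply/eqP. have := @virasoro R V 1 (- 1) v.
by rewrite -!/(L_ _) /= expr1n subrr ?(mul0r, mulr0, scale0r, addr0).
Qed.

Lemma L_vacuum (n : nat) : L_ (n%:Z - 1) (vacuum V) = 0.
Proof. by rewrite /L_ /modeL vacuum_r ?ifF //; lia. Qed.

(** Shows that a functional vanishing on the image of T satisfies the hypothesis of
    [skew_symmetry]. *)
Lemma vacuum_derivatives j w :
  nprod w (- 2 - j%:Z) (vacuum V) =
  (j.+1%:R^-1 : R[i]) *: T (nprod w (- 1 - j%:Z) (vacuum V)).
Proof.
have := T_comm w (vacuum V) (- 1 - j%:Z); rewrite (L_vacuum 0) linear0 add0r =>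
  ->.
rewrite scalerN scalerA (_ : - 1 - j%:Z = - (j.+1)%:Z); last by lia.
rewrite rmorphN mulrN scaleNr opprK mulVf ?pnatr_eq0 // scale1r.
by congr nprod; lia.
Qed.

(** * The weight decomposition *)

Lemma wtP k v : reflect (L0 v = (k%:~R / 2%:R) *: v) (v \in wt k).
Proof. exact: weight_predP. Qed.

Lemma wt_nprod k l n a b : a \in wt k -> b \in wt l ->
  nprod a n b \in wt (k + l - 2 * n - 2).
Proof.
move=> /wtP ha /wtP hb; apply/wtP; rewrite L0_comm ha hb nprodZl linearZ /=.
rewrite -scaleNr -2!scalerDl; congr (_ *: _);
  rewrite !(rmorphD, rmorphN, rmorphM) /=. by field.
Qed.

Lemma wt_L n k v : v \in wt k -> L_ n v \in wt (k - 2 * n).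
Proof.
move=> /wtP hv; apply/wtP; have := @virasoro R V 0 n v.
rewrite -!/(L_ _) hv linearZ /= expr0n subrr mulr0 !mul0r scale0r addr0 add0r.
move=> /eqP; rewrite subr_eq !add0r -scalerDl => /eqP ->; congr (_ *: _).
by rewrite !rmorphD /= !rmorphN /= rmorphM /=; field.
Qed.

Lemma wt_T k v : v \in wt k -> T v \in wt (k + 2).
Proof. exact: wt_L. Qed.

Lemma wt_L1 k v : v \in wt k -> L1 v \in wt (k - 2).
Proof. exact: wt_L. Qed.

Lemma wt_vacuum : vacuum V \in wt 0.
Proof. by apply/wtP; rewrite mul0r scale0r (L_vacuum 1). Qed.

Lemma wt_wcomp (i : nat) v : wcomp i v \in wt i%:Z.
Proof. by apply/wtP/wcomp_weight. Qed.

(** The components are only given as some decomposition into weight vectors; linear independence of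
    distinct weights makes it unique, hence linear. *)
Lemma wcomp_is_linear (i : nat) : linear (@wcomp R V i).
Proof.
move=> x u v.
pose f j := wcomp j (x *: u + v) - (x *: wcomp j u + wcomp j v).
have fW j : f j \in weight_pred V (j%:R / 2%:R).
  by rewrite rpredB ?rpredD ?rpredZ //; apply: wt_wcomp.
have [N1 h1] := wcomp_sum u; have [N2 h2] := wcomp_sum v.
have [N3 h3] := wcomp_sum (x *: u + v).
apply/eqP; rewrite -subr_eq0; apply/eqP.
apply: (@weight_sum_eq0 _ _ (N1 + N2 + N3 + i).+1 f fW _ i); last by lia.
rewrite sumrB -h3 ?big_split /= -?scaler_sumr -?h1 -?h2 ?subrr //; lia.
Qed.

HB.instance Definition _ i := GRing.isLinear.Build R[i] V V *:%R (@wcomp R V i)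
  (wcomp_is_linear i).

(** Applying L_0 - k/2 to the decomposition of v gives a vanishing sum of weight vectors, so each
    component is killed by (j - k)/2. Negative k is allowed, which yields [wt_lt0]. *)
Lemma wcomp_wt (i : nat) k v : v \in wt k ->
  wcomp i v = if i%:Z == k then v else 0.
Proof.
move=> hv; have [N hN] := wcomp_sum v.
pose f (j : nat) := ((j%:R - k%:~R) / 2%:R) *: wcomp j v.
have fW j : f j \in weight_pred V (j%:R / 2%:R) by rewrite rpredZ ?wt_wcomp.
have f0 j : f j = 0.
  apply: (@weight_sum_eq0 _ _ (N + j).+1 f fW); last by lia.
  have /eqP := wtP _ _ hv; rewrite {1 2}(hN (N + j).+1); last by lia.
  rewrite linear_sum scaler_sumr -subr_eq0 -sumrB => /eqP h.
  rewrite -[RHS]h; apply: eq_bigr => l _.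
  by rewrite /= (wtP _ _ (wt_wcomp l v)) -scalerBl -mulrBl.
have w0 (j : nat) : j%:Z != k -> wcomp j v = 0.
  move=> jk; have /eqP := f0 j; rewrite scaler_eq0 mulf_eq0 invr_eq0 pnatr_eq0.
  rewrite orbF subr_eq0 -[j%:R]/(j%:Z%:~R) eqr_int (negbTE jk) /=.
  by move=> /eqP.
case: eqP => [ik|/eqP]; last exact: w0.
rewrite [RHS](hN (N + i).+1); last by lia.
have iN : (i < (N + i).+1)%N by lia.
rewrite (bigD1 (Ordinal iN)) //= big1 ?addr0 // => j.
rewrite -val_eqE /= => /eqP ji; apply: w0; apply/eqP; lia.
Qed.

Lemma wt_lt0 k v : k < 0 -> v \in wt k -> v = 0.
Proof.
move=> k0 hv; have [N hN] := wcomp_sum v.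
rewrite (hN N) // big1 // => i _; rewrite (wcomp_wt _ hv).
by case: eqP => //; lia.
Qed.

Lemma wt0P v : v \in wt 0 -> exists x : R[i], v = x *: vacuum V.
Proof. by move=> /wtP; rewrite mul0r scale0r => /weight0. Qed.

Lemma L_par p n v : par p (L_ n v) = L_ n (par p v).
Proof.
have pL q w : par q w = w -> par q (L_ n w) = L_ n w.
  by have := @nprod_par R V false q _ (n + 1) w (conformal_even V).
have pp q : par q (par q v) = par q v by rewrite par_par eqxx.
rewrite -{1}(par_sum v) linearD linearD /= -(pL _ _ (pp false)) -(pL _ _ (pp
  true)).
by rewrite !par_par; case: p => /=; rewrite ?(add0r, addr0) ?pL.
Qed.

Lemma wt_par p k v : v \in wt k -> par p v \in wt k.
Proof. by move=> /wtP hv; apply/wtP; rewrite -L_par hv linearZ. Qed.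

Lemma wt_dec (P : V -> Prop) : (forall u v, P u -> P v -> P (u + v)) ->
  (forall (k : nat) v, v \in wt k%:Z -> P v) -> forall v, P v.
Proof.
move=> PD Pw v; have [N hN] := wcomp_sum v; rewrite (hN N) //.
elim/big_ind: _ => // [|i _]; last by apply: (Pw i); apply: wt_wcomp.
by apply: (Pw 0%N); apply: rpred0.
Qed.

Lemma wt_par_dec (P : V -> Prop) : (forall u v, P u -> P v -> P (u + v)) ->
  (forall (k : nat) p v, v \in wt k%:Z -> par p v = v -> P v) -> forall v, P v.
Proof.
move=> PD Pw; apply: wt_dec => // k v hv; rewrite -(par_sum v).
by apply: PD; [apply: (Pw k false)|apply: (Pw k true)];
  rewrite ?wt_par ?par_par ?eqxx.
Qed.

(** * Generation by quasi-primary vectors when L_1 V_1 = 0 *)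

Section QuasiPrimary.
Hypothesis L1_wt1 : forall v, v \in wt 2 -> L1 v = 0.

(* The case c > 0 makes the induction go through: y = L1 w must solve the same
   problem one weight lower, with c replaced by k + c. *)
Lemma L1_T_surj (k c : nat) v : (0 < k)%N -> v \in wt k%:Z ->
  exists2 w, w \in wt k%:Z & L1 (T w) + c%:R *: w = v.
Proof.
elim/ltn_ind: k c v => k IH c v k0 hv.
have kc0 : (k + c)%:R != 0 :> R[i] by rewrite pnatr_eq0; lia.
have [y hy Ey] : exists2 y, y \in wt (k%:Z - 2) &
    L1 (T y) + (k + c)%:R *: y = L1 v.
  have [k2|k2] := leqP k 2.
    exists 0; first exact: rpred0.
    rewrite !linear0 addr0; have [kE|kE] := eqVneq k 2%N.
      by move: hv; rewrite kE => /L1_wt1 ->.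
    by rewrite (wt_lt0 _ (wt_L1 hv)) //; lia.
  have k2k : (k - 2 < k)%N by lia.
  have kZ : (k - 2)%N%:Z = k%:Z - 2 by lia.
  by have := IH _ k2k (k + c)%N (L1 v); rewrite kZ; apply; [lia|exact: wt_L1].
have hTy : T y \in wt k%:Z by have := wt_T hy; rewrite subrK.
(* In this weight L_1 T = T L_1 + k, so T (L_1 v - L_1 T y) = (k + c) T y cancels the other terms in
   T y. Hence w is (v - T y) / (k + c). *)
have E : L1 (T (v - T y)) + c%:R *: (v - T y) = (k + c)%:R *: v.
  rewrite !linearB /= (L1_T v) (L1_T (T y)) -Ey linearD linearZ /=.
  rewrite (wtP _ _ hv) (wtP _ _ hTy) !scalerA mulrCA mulfV ?pnatr_eq0 // mulr1.
  have canc (A B C D E : V) : A + (B + C) + D - (A + B) + (E - C) = D + E.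
    rewrite (addrA A) -(addrA (A + B)) [A + B + _]addrC addrK [C + D]addrC.
    by rewrite addrACA subrr addr0.
  by rewrite natrD !scalerDl canc.
exists ((k + c)%:R^-1 *: (v - T y)); first by rewrite rpredZ ?rpredB.
rewrite !linearZ /= -scalerDr E.
by rewrite scalerA mulVf // scale1r.
Qed.

(** Up to doubled weight 2 every vector is quasi-primary. Above it, [L1_T_surj] with c = 0 gives w
    of lower weight with L_1 T w = L_1 v, so v is the quasi-primary v - T w plus T w. *)
Lemma quasi_primary_ind (P : V -> Prop) :
  (forall u v, P u -> P v -> P (u + v)) -> (forall u, P u -> P (T u)) ->
  (forall (k : nat) p v, v \in wt k%:Z -> par p v = v -> L1 v = 0 -> P v) ->
  forall v, P v.
Proof.
move=> PD PT Pq.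
have Pqp (k : nat) v : v \in wt k%:Z -> L1 v = 0 -> P v.
  move=> hv v1; rewrite -(par_sum v).
  by apply: PD; [apply: (Pq k false)|apply: (Pq k true)];
    rewrite ?wt_par ?par_par ?eqxx -?L_par ?v1 ?linear0.
apply: wt_dec => // k; elim/ltn_ind: k => k IH v hv.
have [k2|k2] := leqP k 2.
  apply: (Pqp k) => //; have [kE|kE] := eqVneq k 2%N.
    by move: hv; rewrite kE => /L1_wt1.
  by rewrite (wt_lt0 _ (wt_L1 hv)) //; lia.
have kZ : (k - 2)%N%:Z = k%:Z - 2 by lia.
have := @L1_T_surj (k - 2) 0 (L1 v); rewrite kZ.
case=> [||w hw]; [lia|exact: wt_L1|rewrite scale0r addr0 => Ew].
rewrite -(subrK (T w) v); apply: PD; last by apply/PT/(IH (k - 2)%N);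
  [lia|rewrite kZ].
apply: (Pqp k); last by rewrite linearB /= Ew subrr.
by rewrite rpredB //; have := wt_T hw; rewrite subrK.
Qed.

End QuasiPrimary.
End Conformal.

(** * The phases of g as powers of -i *)

Lemma complex_imag (R : realType) (x y : R) :
  real_complex R x * 'i * real_complex R y = Complex 0 (x * y).
Proof.
rewrite -complexiE; apply/eqP; rewrite eq_complex /=.
by rewrite !(mul0r, mulr0, mulr1, oppr0, add0r, addr0) !eqxx.
Qed.
(** With doubled weights the exponent is (k + p) times -pi i / 2, and each unit contributes one
    quarter turn. *)
Lemma cexp_quarter_turns (R : realType) (k p : nat) :
  cexp (- (real_complex R pi * 'i * (k%:R / 2%:R + p%:R / 2%:R))) =
  (- 'i) ^+ (k + p) :> R[i].
Proof.
have -> : k%:R / 2%:R + p%:R / 2%:R = real_complex R ((k + p)%:R / 2%:R).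
  by rewrite -mulrDl -natrD rmorphM fmorphV !rmorph_nat.
rewrite complex_imag mulrCA mulr_natl.
rewrite /cexp /= oppr0 expR0 !mul1r cosN sinN.
elim: (k + p)%N => [|s IH]; first by rewrite mulr0n cos0 sin0 oppr0.
rewrite exprS -IH mulrSr cosD sinD cos_pihalf sin_pihalf -complexiE.
apply/eqP; rewrite eq_complex /=.
by rewrite !(mul0r, mulr0, mulr1, oppr0, subr0, add0r, addr0, sub0r, mulN1r,
  opprK) !eqxx.
Qed.

(** * The maps phi and g, and the finite expansion of A(z) *)

Section Involution.
Context (R : realType) (V : conformalVertexAlgebra R) (phi : conjInvolution V).
Implicit Types (a b c u v w : V) (p q : bool) (l m n : int) (x : R[i]).

Local Notation T := (@L_ R V (- 1)).
Local Notation L0 := (@L_ R V 0).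
Local Notation L1 := (@L_ R V 1).
Local Notation wt k := (weight_pred V (k%:~R / 2%:R)).

Lemma phiD : {morph phi : u v / u + v}.
Proof. by move=> u v; have := ci_conj_linear phi 1 u v;
  rewrite /= rmorph1 !scale1r. Qed.

Lemma phi0 : phi 0 = 0.
Proof. by apply: (addrI (phi 0)); rewrite -phiD !addr0. Qed.

Lemma phiZ x v : phi (x *: v) = x^* *: phi v.
Proof. by have := ci_conj_linear phi x v 0; rewrite phi0 !addr0. Qed.

Lemma phi_L n v : phi (L_ n v) = L_ n (phi v).
Proof. by rewrite /L_ /modeL ci_nprod ci_conformal. Qed.

Lemma phi_wt k v : v \in wt k -> phi v \in wt k.
Proof.
move=> /wtP hv; apply/wtP; rewrite -phi_L hv phiZ.
by rewrite rmorphM fmorphV rmorph_int rmorph_nat.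
Qed.

Lemma phi_vacuum : phi (vacuum V) = vacuum V.
Proof.
have := ci_nprod phi (vacuum V) (- 1) (phi (vacuum V)).
by rewrite ci_involutive vacuum_l vacuum_r // eqxx ci_involutive.
Qed.

Lemma wcomp_finite v : exists2 N, forall M, (N <= M)%N ->
  v = \sum_(k < M) wcomp k v & forall k : nat, (N <= k)%N -> wcomp k v = 0.
Proof.
have [N hN] := wcomp_sum v; exists N => // k Nk.
apply: (addrI (\sum_(i < k) wcomp i v)).
have /= <- := big_ord_recr k (fun i : 'I_k.+1 => wcomp i v).
by rewrite addr0 -!hN // ltnW.
Qed.

Lemma g_ord v : exists N, forall M, (N <= M)%N ->
  g phi v = \sum_(k < M) \sum_(p : bool)
    (- 'i) ^+ (k + p) *: phi (par p (wcomp k v)).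
Proof.
have [N _ w0] := wcomp_finite v; exists N => M NM.
rewrite /g (@fsum_ord _ _ M) => [|k Mk].
  by apply: eq_bigr => k _; apply: eq_bigr => p _; rewrite cexp_quarter_turns.
by apply: big1 => p _; rewrite w0 ?(leq_trans NM) // linear0 phi0 scaler0.
Qed.

Lemma g_semilinear x u v : g phi (x *: u + v) = x^* *: g phi u + g phi v.
Proof.
have [N1 h1] := g_ord u; have [N2 h2] := g_ord v.
have [N3 h3] := g_ord (x *: u + v).
pose N := (N1 + N2 + N3)%N.
rewrite (h1 N) ?(h2 N) ?(h3 N) /N; try lia.
rewrite scaler_sumr -big_split; apply: eq_bigr => k _ /=.
rewrite scaler_sumr -big_split; apply: eq_bigr => p _ /=.
by rewrite linearP /= linearP /= phiD phiZ scalerDr !scalerA mulrC.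
Qed.

Lemma g_hom (k : nat) p v : v \in wt k%:Z -> par p v = v ->
  g phi v = (- 'i) ^+ (k + p) *: phi v.
Proof.
move=> hv pv; have [N h] := g_ord v.
have kN : (k < (N + k).+1)%N by lia.
have Nk : (N <= (N + k).+1)%N by lia.
rewrite (h _ Nk); transitivity (\sum_(i < (N + k).+1 | i == Ordinal kN)
    (- 'i) ^+ (k + p) *: phi v); last by rewrite big_pred1_eq.
rewrite [RHS]big_mkcond; apply: eq_bigr => i _.
rewrite (wcomp_wt _ hv) eqz_nat -(inj_eq val_inj).
case: eqP => [->|_]; last first.
  by apply: big1 => q _; rewrite linear0 phi0 scaler0.
have pq q : par q v = if q == p then v else 0 by rewrite -{1}pv par_par pv.
transitivity (\sum_(q | q == p) (- 'i) ^+ (k + q) *: phi v).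
  rewrite [RHS]big_mkcond; apply: eq_bigr => q _; rewrite pq.
  by case: ifP => // _; rewrite phi0 scaler0.
by rewrite big_pred1_eq.
Qed.

Lemma gD : {morph g phi : u v / u + v}.
Proof. by move=> u v; have := g_semilinear 1 u v; rewrite rmorph1 !scale1r. Qed.

Lemma g_wt (k : nat) v : v \in wt k%:Z -> g phi v \in wt k%:Z.
Proof.
move=> hv; have gp q : g phi (par q v) \in wt k%:Z.
  by rewrite (g_hom (p := q) (wt_par q hv)) ?par_par ?eqxx // rpredZ ?phi_wt
    ?wt_par.
by rewrite -(par_sum v) gD rpredD.
Qed.

(** T raises the weight by 1, so the phase of g gains e^(-pi i) = -1. *)
Lemma g_T v : g phi (T v) = - T (g phi v).
Proof.
elim/wt_par_dec: v => [u v hu hv|k p v hv pv].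
  by rewrite linearD !gD hu hv linearD opprD.
have hT : T v \in wt (k + 2)%:Z by rewrite PoszD wt_T.
rewrite (g_hom hT (_ : par p _ = _)) ?L_par ?pv // (g_hom hv pv) linearZ /=
  phi_L.
by rewrite addnAC exprD sqrrN sqrCi mulrN1 scaleNr.
Qed.

Lemma iter_L1_wt k v (j : nat) : v \in wt k -> iter j L1 v \in wt (k - 2 *
  j%:Z).
Proof.
move=> hv; elim: j => [|j /wt_L1]; first by rewrite mulr0 subr0.
by rewrite (_ : k - 2 * j%:Z - 2 = k - 2 * j.+1%:Z) //; lia.
Qed.

Lemma iter_L1_eq0 (k j : nat) v : v \in wt k%:Z -> (k < j)%N -> iter j L1 v = 0.
Proof. by move=> /(iter_L1_wt j) h kj; apply: wt_lt0 h; lia. Qed.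

Lemma iter_L1D j u v : iter j L1 (u + v) = iter j L1 u + iter j L1 v.
Proof. by elim: j => //= j ->; rewrite linearD. Qed.

Lemma iter_L1Z j x v : iter j L1 (x *: v) = x *: iter j L1 v.
Proof. by elim: j => //= j ->; rewrite linearZ. Qed.

Lemma iter_L10 j : iter j L1 0 = 0.
Proof. by elim: j => //= j ->; rewrite linear0. Qed.

(** For fixed i there are infinitely many pairs with j - k = i, but the components of g(v) vanish
    for large k, and L_1^j kills doubled weight k once j > k. One square of pairs thus serves all
    i. *)
Lemma A_coef_ord v : exists N0, forall N, (N0 <= N)%N -> forall i, A_coef phi v
  i =
  \sum_(j < N) \sum_(k < N) if i == j%:Z - k%:Z then
    (j`!%:R^-1 : R[i]) *: iter j L1 (wcomp k (g phi v)) else 0.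
Proof.
have [N0 _ hN] := wcomp_finite (g phi v); exists N0 => N N0N i.
rewrite /A_coef fsbig_mkcond.
rewrite (fsbigE [seq (j, k) | j : nat <- index_iota 0 N, k : nat <- index_iota
  0 N]) //.
- rewrite big_mkcond big_allpairs big_mkord; apply: eq_bigr => j _.
  rewrite big_mkord; apply: eq_bigr => k _.
  rewrite in_setT /patch; have [e|/negP e] := boolP (_ \in _).
    by move: e; rewrite inE /= => ->; rewrite eqxx.
  by case: eqP => // ik; case: e; rewrite inE.
- by rewrite allpairs_uniq ?iota_uniq // => -[? ?] [? ?].
move=> [j k] _ /= jkN; rewrite /patch; case: ifP => // _ /=.
have [kN|Nk] := ltnP k N0; last by rewrite hN // iter_L10 scaler0.
rewrite (iter_L1_eq0 (wt_wcomp k _)) ?scaler0 // ltnNge; apply/negP => jk.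
move/negP: jkN; apply; apply/allpairsP; exists (j, k).
by rewrite !mem_index_iota /= (leq_ltn_trans jk) (leq_trans kN).
Qed.

(* The mode a_(n)^dagger in
   Y(A(z) a, z^-1) = sum_n a_(n)^dagger z^(-n-1). *)
Definition adj a n v : V := YA_coef phi a v (- n - 1).

Lemma adj_ord a : exists N0, forall N, (N0 <= N)%N -> forall n v, adj a n v =
  \sum_(k < N) \sum_(j < N) (j`!%:R^-1 : R[i]) *:
    nprod (iter j L1 (wcomp k (g phi a))) (k%:Z - j%:Z - n - 2) v.
Proof.
have [N0 h] := A_coef_ord a; exists N0 => N /h {}h n v.
(* All exponents i = j - k with j, k < N lie in this window of length 2N; exponent i contributes the
   mode -i - n - 2. *)
rewrite /adj /YA_coef (fsbigE [seq i%:Z - N%:Z | i : nat <- index_iota 0 (2 *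
  N)]) //.
- under eq_bigl do rewrite in_setT.
  under eq_bigr do rewrite h /Y_coef nprod_suml.
  rewrite exchange_big [RHS]exchange_big; apply: eq_bigr => j _.
  under eq_bigr do rewrite nprod_suml.
  rewrite exchange_big; apply: eq_bigr => k _.
  rewrite (bigD1_seq (j%:Z - k%:Z)) ?eqxx //=.
  + rewrite big1 ?addr0 ?nprodZl => [|i /negbTE ->]; last by rewrite nprod0l.
    by congr (_ *: nprod _ _ _); lia.
  + have := ltn_ord k; have := ltn_ord j => jN kN.
    apply/mapP; exists (j + N - k)%N; first by rewrite mem_index_iota; lia.
    by lia.
  + by rewrite map_inj_uniq ?iota_uniq // => x y; lia.
- by rewrite map_inj_uniq ?iota_uniq // => x y; lia.
move=> i _ /= /mapP iN; rewrite /Y_coef h [X in nprod X](_ : _ = 0) ?nprod0l //.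
apply: big1 => j _; apply: big1 => k _; case: eqP => // ijk; case: iN.
have := ltn_ord k; have := ltn_ord j => jN kN.
exists (j + N - k)%N; first by rewrite mem_index_iota; lia.
by lia.
Qed.

End Involution.

(** * Adjoint modes and their commutation with T and L_1 *)

Section Adjoint.
Context (R : realType) (V : conformalVertexAlgebra R) (phi : conjInvolution V).
Implicit Types (a b c u v w : V) (p q : bool) (l m n : int) (x : R[i]).

Local Notation T := (@L_ R V (- 1)).
Local Notation L0 := (@L_ R V 0).
Local Notation L1 := (@L_ R V 1).
Local Notation wt k := (weight_pred V (k%:~R / 2%:R)).
Local Notation adj := (adj phi).

Lemma adj_is_linear a n : linear (adj a n).
Proof.
have [N h] := adj_ord phi a; move=> x u v;
  rewrite !(h N) // scaler_sumr -big_split.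
apply: eq_bigr => k _ /=; rewrite scaler_sumr -big_split;
  apply: eq_bigr => j _ /=.
by rewrite linearP scalerDr !scalerA mulrC.
Qed.

HB.instance Definition _ a n := GRing.isLinear.Build R[i] V V *:%R (adj a n)
  (adj_is_linear a n).

Lemma adj_semilinear x a b n v :
  adj (x *: a + b) n v = x^* *: adj a n v + adj b n v.
Proof.
have [N1 h1] := adj_ord phi a; have [N2 h2] := adj_ord phi b.
have [N3 h3] := adj_ord phi (x *: a + b).
rewrite (h1 (N1 + N2 + N3)%N) ?(h2 (N1 + N2 + N3)%N) ?(h3 (N1 + N2 + N3)%N);
  try lia.
rewrite scaler_sumr -big_split; apply: eq_bigr => k _ /=.
rewrite scaler_sumr -big_split; apply: eq_bigr => j _ /=.
rewrite g_semilinear linearP iter_L1D iter_L1Z nprodDl nprodZl scalerDr.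
by rewrite !scalerA mulrC.
Qed.

Lemma adjD n v : {morph (fun a => adj a n v) : a b / a + b}.
Proof. by move=> a b; have := adj_semilinear 1 a b n v;
  rewrite rmorph1 !scale1r. Qed.

(** The length N is left free above k, so that sums for vectors of different weights can be
    aligned. *)
Lemma adj_wt (k N : nat) a n v : a \in wt k%:Z -> (k < N)%N ->
  adj a n v = \sum_(j < N) (j`!%:R^-1 : R[i]) *:
    nprod (iter j L1 (g phi a)) (k%:Z - j%:Z - n - 2) v.
Proof.
move=> ha kN; have ga := g_wt phi ha.
have [N0 h] := adj_ord phi a; rewrite (h (N + N0)%N) ?leq_addl //.
have kM : (k < N + N0)%N by lia.
transitivity (\sum_(i < N + N0 | i == Ordinal kM) \sum_(j < N + N0)
    (j`!%:R^-1 : R[i]) *: nprod (iter j L1 (g phi a)) (k%:Z - j%:Z - n - 2) v).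
  rewrite [RHS]big_mkcond; apply: eq_bigr => i _.
  rewrite (wcomp_wt _ ga) eqz_nat -(inj_eq val_inj).
  case: eqP => [->//|_].
  by apply: big1 => j _; rewrite iter_L10 nprod0l scaler0.
rewrite big_pred1_eq big_split_ord /= [X in _ + X]big1 ?addr0 // => j _.
by rewrite (iter_L1_eq0 ga) ?nprod0l ?scaler0 //; lia.
Qed.

Lemma adj_quasi_primary (k : nat) p a n v :
  a \in wt k%:Z -> par p a = a -> L1 a = 0 ->
  adj a n v = (- 'i) ^+ (k + p) *: nprod (phi a) (k%:Z - n - 2) v.
Proof.
move=> ha pa a1; rewrite (adj_wt _ _ ha (leqnn _)) big_ord_recl big1 => [|j _].
  by rewrite addr0 fact0 invr1 scale1r subr0 (g_hom phi ha pa) nprodZl.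
by rewrite (g_hom phi ha pa) iter_L1Z iterSr -phi_L a1 phi0 iter_L10 scaler0
  nprod0l scaler0.
Qed.

(** The sl_2 formula: the coefficient is the sum over i < j of k - 2i, the doubled weights of L_1^i
    v. It vanishes at j = 0, where the predecessor is truncated. *)
Lemma iter_L1_T (k j : nat) v : v \in wt k%:Z ->
  iter j L1 (T v) = T (iter j L1 v) +
    (j%:Z * (k%:Z - j%:Z + 1))%:~R *: iter j.-1 L1 v.
Proof.
move=> hv; elim: j => [|j IH]; first by rewrite mul0r scale0r addr0.
rewrite iterS IH linearD linearZ /= L1_T (wtP _ _ (iter_L1_wt j hv)).
have -> : (j%:Z * (k%:Z - j%:Z + 1))%:~R *: L1 (iter j.-1 L1 v) =
    (j%:Z * (k%:Z - j%:Z + 1))%:~R *: iter j L1 v.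
  by case: j {IH} => // ; rewrite !mul0r !scale0r.
rewrite scalerA -addrA -scalerDl; congr (_ + _ *: _).
rewrite mulrCA mulfV ?pnatr_eq0 // mulr1 -rmorphD /=; congr (_%:~R); lia.
Qed.

(** The adjoint counterpart of [T_der]. Commuting T past L_1^j gives a second sum in X_(j-1); after
    a shift of index it cancels all of the coefficient of X_j except -n. *)
Lemma adj_T a n v : adj (T a) n v = - n%:~R *: adj a (n - 1) v.
Proof.
elim/wt_dec: a => [a b ha hb|k a ha].
  by rewrite linearD !adjD scalerDr ha hb.
have hT : T a \in wt (k + 2)%:Z by rewrite PoszD wt_T.
pose X j := nprod (iter j L1 (g phi a)) (k%:Z - j%:Z - n - 1) v.
have X0 : X k.+2 = 0 by rewrite /X (iter_L1_eq0 (g_wt phi ha)) ?nprod0l //; lia.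
(* The sum for [T a] is one term longer: one half loses its vanishing last term, the other its
   vanishing first term, and the lengths agree. *)
rewrite (@adj_wt _ k.+3 _ _ _ hT) ?(@adj_wt _ k.+2 _ _ _ ha); try lia.
have E (j : nat) : nprod (iter j L1 (g phi (T a))) ((k + 2)%:Z - j%:Z - n - 2)
  v =
    (k%:Z - j%:Z - n)%:~R *: X j -
    (j%:Z * (k%:Z - j%:Z + 1))%:~R *: X j.-1.
  rewrite g_T -scaleN1r iter_L1Z (iter_L1_T _ (g_wt phi ha)) nprodZl nprodDl
    nprodZl.
  rewrite T_der scaleN1r opprD scaleNr opprK (_ : (k + 2)%:Z - _ - _ - _ = k%:Z
    - j%:Z - n); last by lia.
  congr (_ - _); case: j => [|j]; first by rewrite mul0r !scale0r.
  by congr (_ *: nprod _ _ _); rewrite /=; lia.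
under eq_bigr do rewrite E scalerBr.
rewrite sumrB big_ord_recr /= X0 !scaler0 addr0.
rewrite [X in _ - X]big_ord_recl mul0r scale0r scaler0 add0r -sumrB scaler_sumr.
apply: eq_bigr => j _; rewrite lift0 /= (_ : k%:Z - j%:Z - (n - 1) - 2 = k%:Z -
  j%:Z - n - 1); last by lia.
rewrite !scalerA -scalerBl; congr (_ *: _).
have j0 : j.+1%:R != 0 :> R[i] by rewrite pnatr_eq0.
have f0 : j`!%:R != 0 :> R[i] by rewrite pnatr_eq0 -lt0n fact_gt0.
rewrite (_ : k%:Z - j.+1%:Z + 1 = k%:Z - j%:Z); last by lia.
rewrite factS natrM !(rmorphB, rmorphM) /= -[j.+1%:~R]/(j.+1%:R : R[i]).
rewrite invfM mulrACA mulVf // mul1r -mulrBr mulrC; congr (_ / _).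
by rewrite [_ - _ - n%:~R]addrC addrK.
Qed.

(** The adjoint counterpart of [T_comm]. Commuting L_1 with the modes leaves the extra terms (j X_j
    - X_(j+1)) / j!, whose sum telescopes to 0. *)
Lemma adj_L1 a n v :
  adj a n (L1 v) = L1 (adj a n v) - n%:~R *: adj a (n - 1) v.
Proof.
elim/wt_dec: a => [a b ha hb|k a ha].
  by rewrite !adjD linearD /= ha hb scalerDr addrACA opprD.
pose X j := nprod (iter j L1 (g phi a)) (k%:Z - j%:Z - n - 1) v.
have X0 j : (k < j)%N -> X j = 0.
  by move=> kj; rewrite /X (iter_L1_eq0 (g_wt phi ha)) ?nprod0l.
rewrite !(@adj_wt _ k.+1 _ _ _ ha) //.
have E (j : nat) : nprod (iter j L1 (g phi a)) (k%:Z - j%:Z - n - 2) (L1 v) =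
    L1 (nprod (iter j L1 (g phi a)) (k%:Z - j%:Z - n - 2) v) - n%:~R *: X j
    + j%:R *: X j - X j.+1.
  rewrite L1_comm (wtP _ _ (iter_L1_wt j (g_wt phi ha))) nprodZl scalerA.
  rewrite mulrCA mulfV ?pnatr_eq0 // mulr1 -scalerBl.
  rewrite (_ : k%:Z - j%:Z - n - 2 + 1 = k%:Z - j%:Z - n - 1) -?/(X j);
    last by lia.
  have -> : nprod (L1 (iter j L1 (g phi a))) (k%:Z - j%:Z - n - 2) v = X j.+1.
    by rewrite /X iterS; congr nprod; lia.
  rewrite -[j%:R]/(j%:Z%:~R) -rmorphB /=.
  rewrite (_ : k%:Z - 2 * j%:Z - (k%:Z - j%:Z - n - 2 + 2) = n - j%:Z);
    last by lia.
  have canc (N A B C : V) : N + C + (A - B) - A + B - C = N.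
    by rewrite addrA (addrAC _ (- B)) addrK subrK addrK.
  by rewrite rmorphB scalerBl canc.
pose Z j := (j`!%:R^-1 * j%:R : R[i]) *: X j.
have telescope : \sum_(j < k.+1) (Z j.+1 - Z j) = 0.
  rewrite -(big_mkord xpredT (fun j => Z j.+1 - Z j)) telescope_sumr //.
  by rewrite /Z X0 // scaler0 mulr0 scale0r subrr.
rewrite linear_sum scaler_sumr /= -sumrB -[RHS]subr0 -[X in _ = _ - X]telescope
  -sumrB.
apply: eq_bigr => j _; rewrite E.
rewrite (_ : k%:Z - j%:Z - (n - 1) - 2 = k%:Z - j%:Z - n - 1); last by lia.
have -> : Z j.+1 = (j`!%:R^-1 : R[i]) *: X j.+1.
  by rewrite /Z factS natrM invfM mulrAC mulVf ?mul1r // pnatr_eq0.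
rewrite !(scalerDr, scalerN) !scalerA [n%:~R * _]mulrC opprB.
by rewrite -/(Z j) addrA [L1 (_ *: _)]linearZ.
Qed.

Lemma adj_in_wt (k : nat) l a n v : a \in wt k%:Z -> v \in wt l ->
  adj a n v \in wt (l - k%:Z + 2 * n + 2).
Proof.
move=> ha hv; rewrite (adj_wt _ _ ha (leqnn _)); apply: rpred_sum => j _.
apply: rpredZ; have := wt_nprod (k%:Z - j%:Z - n - 2) (iter_L1_wt j (g_wt phi
  ha)) hv.
rewrite [X in wt X](_ : _ = l - k%:Z + 2 * n + 2) //; lia.
Qed.

End Adjoint.

(** * Symmetries of two- and three-point functions of quasi-primary vectors *)

Section VacuumFunctional.
Context (R : realType) (V : conformalVertexAlgebra R).
Implicit Types (a b c u v w : V) (p q : bool) (l m n : int) (x : R[i]).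

Local Notation T := (@L_ R V (- 1)).
Local Notation L0 := (@L_ R V 0).
Local Notation L1 := (@L_ R V 1).
Local Notation wt k := (weight_pred V (k%:~R / 2%:R)).

Context (ell : {scalar V}).
Hypothesis L1_wt1 : forall v, v \in wt 2 -> L1 v = 0.
Hypothesis ell_wt : forall l v, v \in wt l -> l != 0 -> ell v = 0.

Lemma ell_L1 v : ell (L1 v) = 0.
Proof.
elim/wt_dec: v => [u v hu hv|k v hv]; first by rewrite !linearD /= hu hv addr0.
have [kE|kE] := eqVneq k 2%N.
  by move: hv; rewrite kE => /L1_wt1 ->; rewrite linear0.
by rewrite (ell_wt (wt_L1 hv)) //; lia.
Qed.

Lemma ell_T v : ell (T v) = 0.
Proof.
elim/wt_dec: v => [u v hu hv|k v hv]; first by rewrite !linearD /= hu hv addr0.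
by rewrite (ell_wt (wt_T hv)) //; lia.
Qed.

(** Induction on the weight j of w. Only total weight 0 matters; there [ell] applied to L_1 (c_(m-1)
    w) gives 0 = ell (c_(m-1) L_1 w) + (k - m - 1) ell (c_(m) w). The first term vanishes by
    induction, and k - m - 1 = (k - j)/2 is nonzero. *)
Lemma ell_lower (k : nat) l c w m : c \in wt k%:Z -> L1 c = 0 ->
  w \in wt l -> l < k%:Z -> ell (nprod c m w) = 0.
Proof.
move=> hc c1; have [l0 hw _|l0] := ltP l 0.
  by rewrite (wt_lt0 l0 hw) !linear0.
have -> : l = `|l|%N by lia.
move: `|l|%N => {l l0} j; elim/ltn_ind: j w m => j IH w m hw jk.
have [jm|jm] := eqVneq (k%:Z + j%:Z - 2 * m - 2) 0; last first.
  exact: ell_wt (wt_nprod m hc hw) jm.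
have low : ell (nprod c (m - 1) (L1 w)) = 0.
  have [j2|j2] := ltnP j 2.
    by rewrite (wt_lt0 _ (wt_L1 hw)) ?linear0 //; lia.
  apply: (IH (j - 2)%N); [lia| |lia].
  by have := wt_L1 hw; rewrite (_ : j%:Z - 2 = (j - 2)%N) //; lia.
have := ell_L1 (nprod c (m - 1) w).
rewrite L1_comm c1 nprod0l addr0 (wtP _ _ hc) nprodZl scalerA.
rewrite mulrCA mulfV ?pnatr_eq0 // mulr1 !subrK -scalerBl -rmorphB.
rewrite linearD linearZ /= low add0r => /eqP.
rewrite mulf_eq0 intr_eq0 => /orP[|/eqP //]; lia.
Qed.

(** On doubled weight l >= k the result has positive weight; below k [ell_lower] applies. Up to phi
    and a phase these modes are the adjoints of the c_(j), j >= 0, which kill the vacuum. *)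
Lemma ell_creation (k j : nat) c y : c \in wt k%:Z -> L1 c = 0 ->
  ell (nprod c (k%:Z - 2 - j%:Z) y) = 0.
Proof.
move=> hc c1; elim/wt_dec: y => [u v hu hv|l y hy].
  by rewrite !linearD /= hu hv addr0.
have [lk|lk] := ltnP l k; first exact: ell_lower hc c1 hy lk.
by rewrite (ell_wt (wt_nprod _ hc hy)) //; lia.
Qed.

Lemma ell_skew p q a b l : par p a = a -> par q b = b ->
  ell (nprod b l a) = (-1) ^ (l + 1) * (-1) ^+ (p && q) * ell (nprod a l b).
Proof.
move=> pa qb; apply: skew_symmetry => // j w.
by rewrite vacuum_derivatives linearZ /= ell_T mulr0.
Qed.

(** Skew-symmetry for the functional ell o c_(k-1). It kills the image of T, since commuting T to
    the left leaves a multiple of c_(k-2), which [ell_creation] handles. *)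
Lemma ell_swap_inner (k : nat) p q a b c l : c \in wt k%:Z -> L1 c = 0 ->
  par p a = a -> par q b = b ->
  ell (nprod c (k%:Z - 1) (nprod b l a)) =
  (-1) ^ (l + 1) * (-1) ^+ (p && q) * ell (nprod c (k%:Z - 1) (nprod a l b)).
Proof.
move=> hc c1 pa qb.
apply: (@skew_symmetry _ _ (ell \o nprod c (k%:Z - 1)) p q a b l) => // j w.
rewrite /= vacuum_derivatives !linearZ /=.
have := T_comm c (nprod w (- 1 - j%:Z) (vacuum V)) (k%:Z - 1).
move/(congr1 ell); rewrite ell_T linearB linearZ /=.
have := ell_creation 0 (nprod w (- 1 - j%:Z) (vacuum V)) hc c1.
rewrite (_ : k%:Z - 2 - 0%:Z = k%:Z - 1 - 1); last by lia.
by move=> ->; rewrite mulr0 subr0 => <-; rewrite mulr0.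
Qed.

(* Borcherds' identity, in the modes for which each of its two right-hand sums
   reduces to its first term and its left-hand side vanishes. *)
Lemma ell_swap_outer (ka kb kc : nat) p q r a b c l :
  a \in wt ka%:Z -> b \in wt kb%:Z -> c \in wt kc%:Z ->
  par p a = a -> par q b = b -> par r c = c ->
  L1 a = 0 -> L1 b = 0 -> L1 c = 0 ->
  2 * l = ka%:Z + kc%:Z - kb%:Z ->
  ell (nprod c (kc%:Z - 1) (nprod a (ka%:Z - 1 - l) b)) =
  (-1) ^ l * (-1) ^+ (r && p) *
    ell (nprod a (ka%:Z - 1) (nprod c (kc%:Z - 1 - l) b)).
Proof.
move=> ha hb hc pa pb pc a1 b1 c1 lE.
have [N h] := borcherds_ord b l (kc%:Z - 1 - l) (ka%:Z - 1 - l) pc pa.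
have {h} := congr1 ell (h N.+1 (leqnSn N)).
(* On the left, c_(l+j) a has doubled weight kb - 2 - 2j, less than that of the quasi-primary b, so
   [ell_lower] applies after skew-symmetry. *)
rewrite !linear_sum /= big1 => [|j _]; last first.
  rewrite linearZ /=; set w := nprod c _ a; set i := (X in nprod w X b).
  have pw : par (r (+) p) w = w by apply: nprod_par.
  rewrite (ell_skew i pb pw) (ell_lower i hb b1 (wt_nprod _ hc ha)) ?mulr0 //.
  by lia.
(* On the right, for j >= 1 the outer modes are at most kc - 2 and ka - 2, so [ell_creation] kills
   both terms. *)
rewrite big_ord_recl big1 => [|j _]; last first.
  rewrite lift0 linearZ /= linearB linearZ /=.
  rewrite (_ : kc%:Z - 1 - l + l - j.+1%:Z = kc%:Z - 2 - j%:Z); last by lia.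
  rewrite (_ : l + (ka%:Z - 1 - l) - j.+1%:Z = ka%:Z - 2 - j%:Z); last by lia.
  by rewrite !ell_creation // mulr0 subr0 mulr0.
rewrite /= linearZ /= linearB linearZ /= /binomz big_ord0 divr1 expr0 !mul1r.
rewrite subrK ?(addr0, subr0) [l + _]addrC subrK => /eqP.
by rewrite eq_sym subr_eq0 => /eqP.
Qed.

End VacuumFunctional.

(** * The form attached to a functional: symmetry and invariance *)

Section Form.
Context (R : realType) (V : conformalVertexAlgebra R) (phi : conjInvolution V).
Implicit Types (a b c u v w : V) (p q : bool) (l m n : int) (x : R[i]).

Local Notation T := (@L_ R V (- 1)).
Local Notation L0 := (@L_ R V 0).
Local Notation L1 := (@L_ R V 1).
Local Notation wt k := (weight_pred V (k%:~R / 2%:R)).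
Local Notation adj := (adj phi).

Context (ell : {scalar V}).
Hypothesis L1_wt1 : forall v, v \in wt 2 -> L1 v = 0.
Hypothesis ell_wt : forall l v, v \in wt l -> l != 0 -> ell v = 0.
Hypothesis ell_odd : forall v, par true v = v -> ell v = 0.
Hypothesis ell_phi : forall v, ell (phi v) = (ell v)^*.

(** Here [ell] is linear and stands for the complex conjugate of F, hence the outer conjugation. *)
Definition vacuum_form v u : R[i] := (ell (adj u (- 1) v))^*.

Lemma form_linear v : linear_for *%R (vacuum_form v).
Proof.
by move=> x u w; rewrite /vacuum_form adj_semilinear linearP rmorphD rmorphM /=
  conjCK.
Qed.

Lemma form_semilinear u : linear_for (Num.conj \; *%R) (vacuum_form^~ u).
Proof. by move=> x v w; rewrite /vacuum_form !linearP rmorphD rmorphM. Qed.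

Lemma formDr v : {morph vacuum_form v : u w / u + w}.
Proof. by move=> u w; have := form_linear v 1 u w; rewrite scale1r mul1r. Qed.

Lemma form0r v : vacuum_form v 0 = 0.
Proof. by apply: (addrI (vacuum_form v 0)); rewrite -formDr !addr0. Qed.

Lemma form0l u : vacuum_form 0 u = 0.
Proof. by rewrite /vacuum_form !linear0 conjC0. Qed.

Lemma formZr v x u : vacuum_form v (x *: u) = x * vacuum_form v u.
Proof.
by have := form_linear v x u 0; rewrite form0r !addr0.
Qed.

Lemma formDl u : {morph vacuum_form^~ u : v w / v + w}.
Proof. by move=> v w; rewrite /vacuum_form !linearD rmorphD. Qed.

Lemma formZl x v u : vacuum_form (x *: v) u = x^* * vacuum_form v u.
Proof. by rewrite /vacuum_form !linearZ rmorphM. Qed.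

Lemma form_wt (k l : nat) v u : v \in wt k%:Z -> u \in wt l%:Z -> k != l ->
  vacuum_form v u = 0.
Proof.
move=> hv hu kl; rewrite /vacuum_form (ell_wt (adj_in_wt _ _ hu hv)) ?conjC0
  //; lia.
Qed.

(** Both sides come from the adjoint mode of u at -2: [adj_T] produces it on the left, and [adj_L1]
    on the right together with a vector L_1 w, killed by [ell]. *)
Lemma form_Tr v u : vacuum_form v (T u) = vacuum_form (L1 v) u.
Proof.
rewrite /vacuum_form adj_T adj_L1 rmorphN1 opprK scale1r scaleN1r opprK.
by rewrite linearD (ell_L1 L1_wt1 ell_wt) add0r.
Qed.

Lemma form_L0 v u : vacuum_form (L0 v) u = vacuum_form v (L0 u).
Proof.
elim/wt_dec: v => [v w hv hw|k v hv]; first by rewrite linearD !formDl hv hw.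
elim/wt_dec: u => [u w hu hw|l u hu]; first by rewrite linearD !formDr hu hw.
rewrite (wtP _ _ hv) (wtP _ _ hu) formZl formZr.
have [->|kl] := eqVneq k l; first by rewrite rmorphM fmorphV rmorph_int
  rmorph_nat.
by rewrite (form_wt hv hu kl) !mulr0.
Qed.

(* On a quasi-primary u, both sides vanish: u pairs to zero with T v. *)
Lemma form_Tl v u : vacuum_form (T v) u = vacuum_form v (L1 u).
Proof.
move: v; elim/(quasi_primary_ind L1_wt1): u => [u w hu hw v|u hu v|k p u hu pu
  u1 v].
- by rewrite linearD !formDr hu hw.
(* Since L_1 T = T L_1 + 2 L_0 on both sides, the claim for T u follows from the one for u and
   self-adjointness of L_0. *)
- rewrite form_Tr !L1_T formDl formDr hu form_Tr formZl formZr form_L0.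
  by rewrite rmorph_nat.
rewrite u1 form0r /vacuum_form (adj_quasi_primary _ _ _ hu pu u1) linearZ /=.
have phiu1 : L1 (phi u) = 0 by rewrite -phi_L u1 phi0.
have := T_comm (phi u) v (k%:Z - 1).
move/(congr1 ell); rewrite (ell_T ell_wt) linearB linearZ /=.
have := ell_creation L1_wt1 ell_wt 0 v (phi_wt phi hu) phiu1.
rewrite (_ : k%:Z - 2 - 0%:Z = k%:Z - 1 - 1); last by lia.
rewrite (_ : k%:Z - -1 - 2 = k%:Z - 1); last by lia.
by move=> ->; rewrite mulr0 subr0 => <-; rewrite mulr0 conjC0.
Qed.

Lemma conjC_turn (n : nat) : ((- 'i) ^+ n : R[i])^* = 'i ^+ n.
Proof. by rewrite rmorphXn rmorphN [X in - X]conjCi opprK. Qed.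

Lemma ell_odd_nprod a b n p q : par p a = a -> par q b = b -> p != q ->
  ell (nprod a n b) = 0.
Proof.
move=> pa qb pq; apply: ell_odd; have := nprod_par n pa qb.
by move: pq; case: p q {pa qb} => [] [].
Qed.

(** After reduction to quasi-primary vectors of equal weight and parity, skew-symmetry contributes
    (-1)^(k + p), which turns the phase i^(k + p) into (-i)^(k + p). *)
Lemma form_hermitian v u : vacuum_form v u = (vacuum_form u v)^*.
Proof.
move: v; elim/(quasi_primary_ind L1_wt1): u => [u w hu hw v|u hu v|k p u hu pu
  u1].
- by rewrite formDr formDl rmorphD /= hu hw.
- by rewrite form_Tr form_Tl hu.
elim/(quasi_primary_ind L1_wt1) => [v w hv hw|v hv|l q v hv qv v1].
- by rewrite formDr formDl rmorphD /= hv hw.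
- by rewrite form_Tl form_Tr u1 form0r form0l conjC0.
have [lk|lk] := eqVneq l k; last first.
  by rewrite (form_wt hv hu) // (form_wt hu hv) ?conjC0 1?eq_sym.
rewrite lk in hv; rewrite /vacuum_form conjCK.
rewrite (adj_quasi_primary _ _ _ hu pu u1) (adj_quasi_primary _ _ _ hv qv v1).
rewrite (_ : k%:Z - -1 - 2 = k%:Z - 1); last by lia.
have conjM (y z : R[i]) : (y * z)^* = y^* * z^* by exact: rmorphM.
rewrite !linearZ /= conjM conjC_turn -ell_phi ci_nprod ci_involutive.
have qphi : par q (phi v) = phi v by rewrite ci_par.
have [pq|pq] := eqVneq p q; last first.
  by rewrite (ell_odd_nprod _ pu qphi pq) (ell_odd_nprod _ qphi pu) ?mulr0 //
    eq_sym.
rewrite (ell_skew ell_wt _ qphi pu) subrK mulrA pq andbb; congr (_ * _).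
by rewrite -[(-1) ^ k%:Z]/((-1) ^+ k) -exprD -exprMn mulrN1.
Qed.

(** Compares the phases of v, u and a with the signs of three exchanges. The parity signs multiply
    to (-1)^(p or q), and (p xor q) + p + q = 2 (p or q), so writing -1 as i^2 balances the
    exponents. *)
Lemma phase_identity (ka ku kv s : nat) p q : (ka + ku + kv = 2 * s)%N ->
  (- 'i) ^+ (kv + (p (+) q)) * (-1) ^+ s *
    ((-1) ^+ ((p (+) q) && p) * (-1) ^+ (q && (p (+) q)) * (-1) ^+ (p && q)) =
  'i ^+ (ku + q) * 'i ^+ (ka + p) :> R[i].
Proof.
move=> sE; pose t := (s + (p || q))%N.
have -> : (-1) ^+ ((p (+) q) && p) * (-1) ^+ (q && (p (+) q)) * (-1) ^+ (p && q)
    = (-1) ^+ (p || q) :> R[i].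
  by rewrite -!signr_addb; case: p q {t} => [] [].
rewrite -mulrA -[(-1) ^+ s * _]exprD -/t -[-1 in X in _ * X]sqrCi -exprM.
have -> : (2 * t = kv + (p (+) q) + ((ku + q) + (ka + p)))%N.
  by rewrite /t; case: p q {t} => [] [] /=; lia.
rewrite (exprD _ (kv + _)%N) mulrA -exprMn mulNr -expr2 sqrCi opprK expr1n
  mul1r.
by rewrite exprD.
Qed.

Lemma form_invariant_quasi_primary (ka ku kv : nat) p q r a u v n :
  a \in wt ka%:Z -> u \in wt ku%:Z -> v \in wt kv%:Z ->
  par p a = a -> par q u = u -> par r v = v ->
  L1 a = 0 -> L1 u = 0 -> L1 v = 0 ->
  vacuum_form v (nprod a n u) = vacuum_form (adj a n v) u.
Proof.
move=> ha hu hv pa pu pv a1 u1 v1.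
have hc := phi_wt phi hv; have pc : par r (phi v) = phi v by rewrite ci_par.
have c1 : L1 (phi v) = 0 by rewrite -phi_L v1 phi0.
have hau := wt_nprod n ha hu; have pau := nprod_par n pa pu.
have conjM (y z : R[i]) : (y * z)^* = y^* * z^* by exact: rmorphM.
rewrite form_hermitian /vacuum_form conjCK.
rewrite (adj_quasi_primary _ _ _ hv pv v1) (adj_quasi_primary _ _ _ hu pu u1).
rewrite (adj_quasi_primary _ _ _ ha pa a1).
rewrite (_ : kv%:Z - -1 - 2 = kv%:Z - 1); last by lia.
rewrite (_ : ku%:Z - -1 - 2 = ku%:Z - 1); last by lia.
rewrite !linearZ /= !conjM !conjC_turn -ell_phi !ci_nprod !ci_involutive.
(* Unless a_(n) u has the weight and parity of v, both sides vanish. *)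
have [E|E] := eqVneq (ka%:Z + ku%:Z - 2 * n - 2) kv%:Z; last first.
  rewrite (ell_wt (wt_nprod _ hc hau)); last by lia.
  rewrite (ell_wt (wt_nprod _ hu (wt_nprod _ ha hc))) ?mulr0 //; lia.
have [par0|par0] := eqVneq r (p (+) q); last first.
  rewrite (ell_odd_nprod _ pc pau par0).
  rewrite (ell_odd_nprod _ pu (nprod_par _ pa pc)) ?mulr0 //.
  by move: par0; case: (p) (q) (r) => [] [] [].
pose l := ka%:Z - 1 - n.
have nE : n = ka%:Z - 1 - l by rewrite /l; lia.
have l2 : 2 * l = ka%:Z + kv%:Z - ku%:Z by rewrite /l; lia.
(* With c = phi(v), three exchanges lead from c (a u) to a (c u), then a (u c), then u (a c). *)
rewrite {1}nE (ell_swap_outer L1_wt1 ell_wt ha hu hc pa pu pc a1 u1 c1 l2).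
rewrite (ell_swap_inner L1_wt1 ell_wt _ ha a1 pu pc).
have l3 : 2 * (ku%:Z - (kv%:Z - 1 - l) - 1) = ku%:Z + ka%:Z - kv%:Z by lia.
have rE : kv%:Z - 1 - l = ku%:Z - 1 - (ku%:Z - (kv%:Z - 1 - l) - 1) by lia.
rewrite {2}rE (ell_swap_outer L1_wt1 ell_wt hu hc ha pu pc pa u1 c1 a1 l3).
rewrite (_ : ka%:Z - 1 - (ku%:Z - (kv%:Z - 1 - l) - 1) = ka%:Z - n - 2);
  last by lia.
rewrite !mulrA; congr (_ * _).
(* The sign exponents of the three exchanges add up to ku + l, which is half of ka + ku + kv. *)
have [s sE] : {s : nat | s%:Z = ku%:Z + l} by exists (absz (ku%:Z + l)); lia.
have <- := @phase_identity ka ku kv s p q ltac:(lia).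
have -> : (-1) ^+ s = (-1) ^ l * (-1) ^ (kv%:Z - 1 - l + 1) *
    (-1) ^ (ku%:Z - (kv%:Z - 1 - l) - 1) :> R[i].
  have N1 : -1 != 0 :> R[i] by rewrite oppr_eq0 oner_eq0.
  by rewrite -!expfzDr // -[LHS]/((-1) ^ s%:Z) sE; congr (_ ^ _); lia.
rewrite -par0; ring.
Qed.

(** T is stripped from a, then u, then v, each time by a rule for modes and its adjoint counterpart.
    Taking v last makes L_1 a = L_1 u = 0 available when T v is moved across. *)
Lemma form_invariant a n u v : vacuum_form v (nprod a n u) = vacuum_form (adj a
  n v) u.
Proof.
elim/(quasi_primary_ind L1_wt1): a n u v
  => [a b ha hb|a ha|ka p a ha pa a1] n u v.
- by rewrite nprodDl formDr adjD formDl ha hb.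
- rewrite T_der formZr adj_T formZl ha; congr (_ * _).
  by rewrite rmorphN rmorph_int.
elim/(quasi_primary_ind L1_wt1): u n v => [u w hu hw|u hu|ku q u hu qu u1] n v.
- by rewrite linearD !formDr hu hw.
- have -> : nprod a n (T u) = T (nprod a n u) + n%:~R *: nprod a (n - 1) u.
    by rewrite T_comm subrK.
  rewrite formDr formZr !form_Tr !hu adj_L1 -scaleNr formDl formZl.
  by rewrite rmorphN rmorph_int mulNr subrK.
elim/(quasi_primary_ind L1_wt1): v n => [v w hv hw|v hv|kv r v hv rv v1] n.
- by rewrite linearD !formDl hv hw.
- rewrite form_Tl L1_comm u1 a1 linear0 nprod0l !add0r (wtP _ _ ha) nprodZl.
  rewrite scalerA mulrCA mulfV ?pnatr_eq0 // mulr1 -scalerBl -rmorphB formZr hv.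
  rewrite !(adj_quasi_primary _ _ _ ha pa a1).
  have -> : nprod (phi a) (ka%:Z - n - 2) (T v) =
     T (nprod (phi a) (ka%:Z - n - 2) v) +
     (ka%:Z - n - 2)%:~R *: nprod (phi a) (ka%:Z - (n + 1) - 2) v.
    rewrite T_comm (_ : ka%:Z - n - 2 - 1 = ka%:Z - (n + 1) - 2) ?subrK //; lia.
  rewrite scalerDr formDl !formZl form_Tl u1 form0r mulr0 add0r.
  rewrite mulrCA rmorph_int (_ : ka%:Z - n - 2 = ka%:Z - (n + 2)) //; lia.
exact: form_invariant_quasi_primary ha hu hv pa qu rv a1 u1 v1.
Qed.

End Form.

(** * Pairing with the vacuum as the isomorphism *)

Section Isomorphism.
Context (R : realType) (V : conformalVertexAlgebra R) (phi : conjInvolution V).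
Implicit Types (a b c u v w : V) (p q : bool) (l m n : int) (x : R[i]).

Local Notation T := (@L_ R V (- 1)).
Local Notation L0 := (@L_ R V 0).
Local Notation L1 := (@L_ R V 1).
Local Notation wt k := (weight_pred V (k%:~R / 2%:R)).
Local Notation "1v" := (vacuum V).
Local Notation adj := (adj phi).

Lemma conformal_vector_wt : conformal_vector V \in wt 4.
Proof.
apply/wtP; have := conformal_weight V; rewrite /L_ => ->.
by congr (_ *: _); rewrite -[4%:~R]/(4%:R : R[i]) (natrM _ 2 2) mulfK //
  pnatr_eq0.
Qed.

(** The conformal vector is L_(-2) 1, and [L_1, L_(-2)] = 3 L_(-1) has no central term; L_1 and
    L_(-1) kill the vacuum. *)
Lemma L1_conformal_vector : L1 (conformal_vector V) = 0.
Proof.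
have LE : L_ (- 2) 1v = conformal_vector V by rewrite /L_ /modeL vacuum_r.
have := @virasoro R V 1 (- 2) 1v; rewrite -!/(L_ _) LE (L_vacuum V 2) linear0
  subr0.
by move=> ->; rewrite (L_vacuum V 0) mulr0 mul0r scale0r scaler0 addr0.
Qed.

(** The conformal vector is even, quasi-primary, of doubled weight 4 and fixed by phi, so its phase
    is (-i)^4 = 1. *)
Lemma adj_conformal_vector n v : adj (conformal_vector V) (n + 1) v = L_ (- n)
  v.
Proof.
rewrite (@adj_quasi_primary _ _ phi 4 false _ _ _ conformal_vector_wt
  (conformal_even V)
  L1_conformal_vector) ci_conformal addn0.
rewrite (exprM _ 2 2) sqrrN sqrCi sqrrN expr1n scale1r /L_ /modeL.
by congr nprod; lia.
Qed.

Lemma adj_vacuum v : adj 1v (- 1) v = v.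
Proof.
by rewrite (@adj_quasi_primary _ _ phi 0 false _ _ _ (wt_vacuum V) (vacuum_even
  V)
  (L_vacuum V 2)) phi_vacuum expr0 scale1r vacuum_l.
Qed.

Lemma adj_invariant (B : V -> V -> R[i]) : Defs.invariant phi B <->
  forall a n u v, B v (nprod a n u) = B (adj a n v) u.
Proof.
split=> [h a n u v|h a u v m].
  have := h a u v (- n - 1); rewrite /Y_coef /adj.
  by rewrite (_ : - (- n - 1) - 1 = n) //; lia.
by rewrite /Y_coef h /adj (_ : - (- m - 1) - 1 = m) //; lia.
Qed.

(** * An invariant form is determined by its pairing of V_0 with the vacuum *)

Section InvariantForms.
Variable B : V -> V -> R[i].
Hypotheses (hB : Defs.hermitian B) (iB : Defs.invariant phi B).

Lemma invariant_L n u v : B v (L_ n u) = B (L_ (- n) v) u.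
Proof. by rewrite -adj_conformal_vector -(adj_invariant B).1. Qed.

Lemma invariant_vacuumr u v : B v u = B (adj u (- 1) v) 1v.
Proof. by rewrite -(adj_invariant B).1 // vacuum_r. Qed.

Lemma hermitianZl x v u : B (x *: v) u = x^* * B v u.
Proof.
case: hB => Bl _ _; have /= := Bl u (-1) 0 0.
rewrite scaler0 addr0 rmorphN1 mulN1r addNr => B0.
by have /= := Bl u x v 0; rewrite B0 !addr0.
Qed.

Lemma hermitian0r v : B v 0 = 0.
Proof.
case: hB => _ Br _; have := Br v (-1) 0 0.
by rewrite scaler0 addr0 mulN1r addNr.
Qed.

Lemma hermitianDl u : {morph B^~ u : v w / v + w}.
Proof.
case: hB => Bl _ _ v w; have /= := Bl u 1 v w.
by rewrite scale1r rmorph1 mul1r.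
Qed.

Lemma invariant_vacuum_eq0 : (forall v, v \in wt 0 -> B v 1v = 0) ->
  forall v u, B v u = 0.
Proof.
move=> B0 v u; rewrite invariant_vacuumr; move: (adj _ _ _) => {u}w.
elim/wt_dec: w => [a b ha hb|k w hw]; first by rewrite hermitianDl ha hb addr0.
have [k0|k0] := eqVneq k 0%N; first by apply: B0; rewrite k0 in hw.
have := invariant_L 0 1v w; rewrite oppr0 (L_vacuum V 1) (wtP _ _ hw)
  hermitianZl.
rewrite hermitian0r => /esym/eqP.
rewrite mulf_eq0 rmorphM fmorphV rmorph_int rmorph_nat.
by rewrite mulf_eq0 invr_eq0 !pnatr_eq0 (negbTE k0) /= => /eqP.
Qed.

End InvariantForms.

Lemma g_wt0 (v : wspace V 0) : g phi v = phi v.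
Proof.
have hv : (v : V) \in wt 0 by rewrite mul0r; exact: valP.
have [x vE] := wt0P hv.
by rewrite (@g_hom _ _ phi 0 false _ hv) ?scale1r // vE linearZ /= vacuum_even.
Qed.

Lemma restrict_subproof (B : invariantForm phi) :
  (fun v : wspace V 0 => B v 1v) \in functional_pred phi.
Proof.
have /asboolP[hB iB] := valP B; have [Bl _ Bh] := hB.
apply/asboolP; split=> [x u v|v|v].
- exact: Bl.
- have /= := invariant_L iB (- 1) 1v v; rewrite opprK (L_vacuum V 0) => <-.
  exact: hermitian0r.
have hv : (v : V) \in wt 0 by rewrite mul0r; exact: valP.
(* As V_0 = C 1, the condition amounts to B(1, 1) being real. *)
rewrite /= g_wt0; have [x ->] := wt0P hv.
rewrite phiZ phi_vacuum !(hermitianZl hB) conjCK.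
by rewrite [RHS](rmorphM Num.conj) /= conjCK -Bh.
Qed.

Definition restrict (B : invariantForm phi) : realFunctional phi :=
  RealFunctional (restrict_subproof B).

Lemma restrict_is_linear : linear restrict.
Proof. by move=> r B1 B2; apply/val_inj/funext. Qed.

HB.instance Definition _ := GRing.isLinear.Build R _ _ *:%R restrict
  restrict_is_linear.

Lemma restrict_inj : injective restrict.
Proof.
move=> B1 B2 eB; apply/eqP; rewrite -subr_eq0; apply/eqP; set B := B1 - B2.
have B0 v : v \in wt 0 -> (B v 1v : R[i]) = 0.
  rewrite mul0r => hv; have : restrict B = 0 by rewrite linearB /= eB subrr.
  by move=> /(congr1 (fun F : realFunctional phi => F (Wspace hv))).
have /asboolP[hB iB] := valP B.
apply/val_inj/funext => v; apply/funext => u.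
exact: (invariant_vacuum_eq0 hB iB B0).
Qed.

Lemma wcomp_par (i : nat) p v : wcomp i (par p v) = par p (wcomp i v).
Proof.
elim/wt_dec: v => [u v hu hv|k v hv]; first by rewrite !linearD /= hu hv.
rewrite (wcomp_wt _ hv) (wcomp_wt _ (wt_par p hv)).
by case: ifP => // _; rewrite linear0.
Qed.

Lemma wcomp_phi (i : nat) v : wcomp i (phi v) = phi (wcomp i v).
Proof.
elim/wt_dec: v => [u v hu hv|k v hv].
  by rewrite phiD !linearD /= phiD hu hv.
rewrite (wcomp_wt _ hv) (wcomp_wt _ (phi_wt phi hv)).
by case: ifP => // _; rewrite phi0.
Qed.

(** * Construction of a form from a functional *)

Section Extension.
Variable F : realFunctional phi.

Lemma wcomp0_wt v : wcomp 0 v \in weight_pred V 0.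
Proof. by have := wt_wcomp 0 v; rewrite mul0r. Qed.

Definition vacuum_part v : wspace V 0 := Wspace (wcomp0_wt v).

(** The functional [ell] attached to F: extended by zero to the other weights and conjugated to
    become linear. *)
Definition extension v : R[i] := (F (vacuum_part v))^*.

Lemma extension_is_linear : linear_for *%R extension.
Proof.
have /asboolP[Fl _ _] := valP F.
move=> x u v; rewrite /extension.
have -> : vacuum_part (x *: u + v) = x *: vacuum_part u + vacuum_part v.
  by apply: val_inj; rewrite /= linearP.
have /= -> := Fl x (vacuum_part u) (vacuum_part v).
by rewrite (rmorphD Num.conj) (rmorphM Num.conj) /= conjCK.
Qed.

HB.instance Definition _ := GRing.isLinear.Build R[i] V R[i] *%R extension
  extension_is_linear.

Lemma functional0 : (F 0 : R[i]) = 0.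
Proof.
have /asboolP[Fl _ _] := valP F.
have /= := Fl (-1) 0 0; rewrite scaler0 addr0 rmorphN1 mulN1r addNr.
by [].
Qed.

Lemma extension_wt l v : v \in wt l -> l != 0 -> extension v = 0.
Proof.
move=> hv l0; rewrite /extension (_ : vacuum_part v = 0) ?functional0 ?conjC0
  //.
apply: val_inj; rewrite /= (wcomp_wt _ hv).
by case: eqP => // e; rewrite -e eqxx in l0.
Qed.

Lemma extension_odd v : par true v = v -> extension v = 0.
Proof.
move=> pv; rewrite /extension (_ : vacuum_part v = 0) ?functional0 ?conjC0 //.
apply: val_inj => /=.
rewrite -pv wcomp_par; have [x ->] := wt0P (wt_wcomp 0 v).
by rewrite linearZ /= -(vacuum_even V) par_par scaler0.
Qed.

Lemma extension_phi v : extension (phi v) = (extension v)^*.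
Proof.
have /asboolP[_ _ Fg] := valP F.
rewrite /extension -(Fg (vacuum_part v)); congr (_^*); congr (F _);
  apply: val_inj.
by rewrite /= wcomp_phi; exact/esym/(g_wt0 (vacuum_part v)).
Qed.

(** A nonzero F on V_0 = C 1 has F(1) nonzero, so F(L_1 v) = 0 forces the multiple L_1 v of 1 to
    vanish. *)
Lemma functional_L1_eq0 : (exists v : wspace V 0, (F v : R[i]) != 0) ->
  forall v, v \in wt 2 -> L1 v = 0.
Proof.
move=> [u Fu] v hv; have /asboolP[Fl F1 _] := valP F.
have F0 := functional0.
have FZ x (w : wspace V 0) : (F (x *: w) : R[i]) = x^* * F w.
  by have /= := Fl x w 0; rewrite F0 !addr0.
have hv1 : v \in weight_pred V 1 by rewrite -[1](mulfV (_ : 2%:R != 0)) //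
  pnatr_eq0.
have h1 : 1v \in weight_pred V 0 by rewrite -(mul0r 2%:R^-1); exact: wt_vacuum.
have F1v : (F (Wspace h1) : R[i]) != 0.
  apply: contra_neq Fu => Fv.
  have [x ux] : exists x : R[i], (u : V) = x *: 1v.
    by apply: wt0P; rewrite mul0r; exact: valP.
  have -> : u = x *: Wspace h1 by apply: val_inj.
  by rewrite FZ Fv mulr0.
have /eqP : (F (Defs.L1 (Wspace hv1)) : R[i]) = 0 by exact: F1.
have [x xE] : exists x : R[i], L1 v = x *: 1v.
  by apply: wt0P; have := wt_L1 hv; rewrite subrr.
have -> : Defs.L1 (Wspace hv1) = x *: Wspace h1 by apply: val_inj.
rewrite FZ mulf_eq0 (negbTE F1v) orbF conjC_eq0 => /eqP x0.
by rewrite xE x0 scale0r.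
Qed.

Lemma restrict_surj : exists B, restrict B = F.
Proof.
have [Fn0|F0] := pselect (exists v : wspace V 0, (F v : R[i]) != 0); last first.
  exists 0; apply/val_inj/funext => v /=; apply/esym/eqP.
  by apply: contrapT => /negP Fv; apply: F0; exists v.
have L1_wt1 := functional_L1_eq0 Fn0.
have formP : (vacuum_form phi extension : V -> V -> Rcomplex R) \in
  invform_pred phi.
  apply/asboolP; split.
    split.
    - exact: form_semilinear.
    - exact: form_linear.
    - exact: (form_hermitian L1_wt1 extension_wt extension_odd extension_phi).
  apply/adj_invariant.
  exact: (form_invariant L1_wt1 extension_wt extension_odd extension_phi).
exists (InvariantForm formP); apply/val_inj/funext => v.
(* The adjoint mode of the vacuum at -1 is the identity, and the two conjugations cancel. *)
rewrite /= /vacuum_form adj_vacuum /= /extension conjCK; congr (F _).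
have hv : (v : V) \in wt 0 by rewrite mul0r; exact: valP.
by apply: val_inj; rewrite /= (wcomp_wt _ hv).
Qed.

End Extension.
End Isomorphism.

Theorem theorem4p3 (R : realType) (V : conformalVertexAlgebra R)
    (phi : conjInvolution V) :
  exists f : {linear invariantForm phi -> realFunctional phi}, bijective f.
Proof.
exists (@restrict R V phi).
(* Choice yields a right inverse; injectivity makes it two-sided. *)
have [h hK] := choice (@restrict_surj R V phi).
by exists h => // B; apply: restrict_inj; rewrite hK.
Qed.
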